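(* There exist constants $\lambda_0<1$, $\epsilon>0$, $c>0$ and $n_0$ such that for every $n\ge n_0$ with $n\equiv 0\pmod 3$ there is a $6$-regular graph $G=(V,E)$ on $n$ vertices with $\lambda(G)\le\lambda_0$, in which every vertex is contained in an induced cycle of length at least $\epsilon\log n$, together with a starting vertex $v_0$ and a rule $\mathcal{R}$, such that the greedy random walk on $G$ with rule $\mathcal{R}$ started at $v_0$ satisfies $\mathbb{E}[C_E(G)]\ge c\,n\log n$.
   Context: A greedy random walk (GRW) on a connected locally finite graph $G=(V,E)$ with rule $\mathcal{R}$ started at $v_0$: $X_0=v_0$; with $H_t=\{\{X_{s-1},X_s\}:0<s\le t\}$ and $J_t(v)=\{e\in E: v\in e, e\notin H_t\}$, if $J_t(X_t)\ne\emptyset$ then $X_{t+1}=w$ for some $w$ with $\{X_t,w\}\in J_t(X_t)$, chosen according to an arbitrary (possibly randomized, history-dependent) rule $\mathcal{R}$; if $J_t(X_t)=\emptyset$ then $X_{t+1}$ is a uniformly random neighbor of $X_t$. $C_E(G)=\min\{t:H_t=E\}$ is the edge cover time. For a $d$-regular graph with normalized adjacency matrix $A$ ($A(u,v)=1/d$ for edges, $0$ otherwise) with eigenvalues $1=\lambda_1\ge\dots\ge\lambda_n\ge-1$, $\lambda(G)=\max_{2\le i\le n}|\lambda_i|$. *)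

(* Defs.v *)
From Stdlib Require Import Reals Lra Arith List Bool.
Import ListNotations.
Open Scope R_scope.

Definition sumR {A : Type} (l : list A) (f : A -> R) : R :=
  fold_right (fun x acc => f x + acc) 0 l.

Definition simple_graph (n : nat) (adj : nat -> nat -> bool) : Prop :=
  (forall u v, adj u v = true -> (u < n)%nat /\ (v < n)%nat) /\
  (forall u v, adj u v = adj v u) /\
  (forall u, adj u u = false).

Definition neighbors (n : nat) (adj : nat -> nat -> bool) (v : nat) : list nat :=
  filter (adj v) (seq 0 n).

Definition deg (n : nat) (adj : nat -> nat -> bool) (v : nat) : nat :=
  length (neighbors n adj v).

Definition regular (n : nat) (adj : nat -> nat -> bool) (d : nat) : Prop :=
  forall v, (v < n)%nat -> deg n adj v = d.

Definition nadj (adj : nat -> nat -> bool) (d : nat) (u v : nat) : R :=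
  if adj u v then / INR d else 0.

(* lambda(G) <= lam : the eigenvalues (with multiplicity) of the symmetric
   matrix A are given by an orthonormal eigenbasis; after removing one copy of
   the top eigenvalue 1 = lambda_1, all remaining ones have |.| <= lam. *)
Definition spectral_gap_le (n : nat) (adj : nat -> nat -> bool) (d : nat)
    (lam : R) : Prop :=
  exists (vec : nat -> nat -> R) (mu : nat -> R),
    (forall i j, (i < n)%nat -> (j < n)%nat ->
       sumR (seq 0 n) (fun k => vec i k * vec j k) = if Nat.eqb i j then 1 else 0) /\
    (forall i u, (i < n)%nat -> (u < n)%nat ->
       sumR (seq 0 n) (fun v => nadj adj d u v * vec i v) = mu i * vec i u) /\
    mu 0%nat = 1 /\
    (forall i, (1 <= i < n)%nat -> Rabs (mu i) <= lam).

Definition induced_cycle (n : nat) (adj : nat -> nat -> bool) (c : list nat) : Prop :=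
  let L := length c in
  (3 <= L)%nat /\ NoDup c /\ Forall (fun x => (x < n)%nat) c /\
  (forall i j, (i < L)%nat -> (j < L)%nat ->
     (adj (nth i c 0%nat) (nth j c 0%nat) = true <->
      (j = (i + 1) mod L \/ i = (j + 1) mod L)%nat)).

(* A history h = [X_0; ...; X_t] (non-empty list of vertices). *)

Definition traversed (h : list nat) (u v : nat) : bool :=
  existsb (fun p => (Nat.eqb (fst p) u && Nat.eqb (snd p) v)
                    || (Nat.eqb (fst p) v && Nat.eqb (snd p) u))
          (combine h (tl h)).

Definition current (h : list nat) : nat := last h 0%nat.

Definition has_unused (n : nat) (adj : nat -> nat -> bool) (h : list nat) : bool :=
  existsb (fun w => adj (current h) w && negb (traversed h (current h) w)) (seq 0 n).

Definition all_covered (n : nat) (adj : nat -> nat -> bool) (h : list nat) : bool :=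
  forallb (fun u => forallb (fun v => negb (adj u v) || traversed h u v) (seq 0 n))
          (seq 0 n).

(* A (randomized, history-dependent) rule: rule h w = probability that the walk
   with history h moves to w, used when an unused incident edge exists; it must
   be a probability distribution supported on unused incident edges. *)
Definition valid_rule (n : nat) (adj : nat -> nat -> bool)
    (rule : list nat -> nat -> R) : Prop :=
  forall h, has_unused n adj h = true ->
    (forall w, 0 <= rule h w) /\
    (forall w, rule h w <> 0 ->
        adj (current h) w = true /\ traversed h (current h) w = false) /\
    sumR (seq 0 n) (rule h) = 1.

Definition grw_step (n : nat) (adj : nat -> nat -> bool)
    (rule : list nat -> nat -> R) (h : list nat) (w : nat) : R :=
  if has_unused n adj h then rule h w
  else if adj (current h) w then / INR (deg n adj (current h)) else 0.

Fixpoint not_covered_prob (n : nat) (adj : nat -> nat -> bool)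
    (rule : list nat -> nat -> R) (h : list nat) (k : nat) : R :=
  match k with
  | O => if all_covered n adj h then 0 else 1
  | S k' => sumR (seq 0 n)
              (fun w => grw_step n adj rule h w *
                        not_covered_prob n adj rule (h ++ [w]) k')
  end.

Definition cover_tail (n : nat) (adj : nat -> nat -> bool)
    (rule : list nat -> nat -> R) (v0 t : nat) : R :=
  not_covered_prob n adj rule [v0] t.

(* E[C_E(G)] >= x, where E[C_E] = sum_{t>=0} P(C_E > t) (possibly +infinity) *)
Definition expected_cover_time_ge (n : nat) (adj : nat -> nat -> bool)
    (rule : list nat -> nat -> R) (v0 : nat) (x : R) : Prop :=
  forall y, y < x -> exists N : nat,
    y <= sumR (seq 0 N) (fun t => cover_tail n adj rule v0 t).

(* Main.v *)
(** The base of the graph is Margulis' expander on (Z/p)^2, with the two shears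
    and the two unit translations as generators.  Each of its points is blown up
    to a cell, a fixed graph on 14 or 15 vertices, which makes the graph simple,
    6-regular and of any prescribed large order, and puts every vertex on a
    triangle and on an induced cycle running along a row of cells.  Poincaré's
    inequality passes from the base to the graph; on the base, the Fourier
    transform turns the translations into multiplications and reduces it to a
    Hardy inequality for the shears away from 0, which follows from a bounded
    flow directed by the Euclidean algorithm.  The triangles bound the spectrum
    away from -1.

    One triangle per cell is kept apart.  The rule uses the edges of these
    triangles only when no other edge is available.  Both edge classes have even
    degrees, so every greedy excursion returns to the vertex where it began and
    meets no new triangle except that of the cell of this vertex.  Hence the walk
    is a simple random walk interrupted by excursions, and it must visit every
    cell.  Restrict to cells that are pairwise far apart for the Green function
    truncated at time p.  When j of them are unvisited, H_j / (2 kappa) minus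
    1 / (kappa j) times the sum of their Green functions, with kappa of order
    1/n, loses at most 1 in expectation per step, and it starts at order n log n. *)

Require Import Defs.
From Stdlib Require Import Reals Arith List.
From Stdlib Require Import Lra Lia Psatz Bool.
Import ListNotations.
Open Scope R_scope.

(** * Sums and parities over lists *)

(** The truncation time [p] is a compromise. The Green function of a cell, summed over all the
    cells, is of order [p], so only a fraction of order [1/p] of the [p^2] cells can be kept
    pairwise far apart; their number is still a power of [n], and its logarithm of order [log n]. On
    the other hand [p] is much longer than the mixing time, of order [log n], and this makes the
    error of the truncation of order [1/n] per step.

    A potential is used rather than hitting times because the expected cover time is a sum of tails
    defined by recursion on histories: an inequality for one step passes through this recursion,
    without stopping times or a measure on infinite walks.

    The cells repair Margulis' graph, in which a shear fixes the points of an axis and agrees with a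
    translation at some others: loops and parallel edges become edges between distinct ports. *)

Section Sums.
Context {A : Type}.
Implicit Types (l : list A) (f g : A -> R).

Lemma sumR_ext l f g : (forall x, In x l -> f x = g x) -> sumR l f = sumR l g.
Proof.
induction l as [|a l IH]; intros H; simpl; auto.
rewrite (H a (or_introl eq_refl)), IH; auto. intros x Hx; apply H; right; auto.
Qed.

Lemma sumR_le l f g : (forall x, In x l -> f x <= g x) -> sumR l f <= sumR l g.
Proof.
induction l as [|a l IH]; intros H; simpl; [lra|].
apply Rplus_le_compat; [apply H; left; auto | apply IH; intros; apply H; right; auto].
Qed.

Lemma sumR_0 l f : (forall x, In x l -> f x = 0) -> sumR l f = 0.
Proof.
induction l as [|a l IH]; intros H; simpl; auto.
rewrite (H a (or_introl eq_refl)), IH; [lra|]. intros x Hx; apply H; right; auto.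
Qed.

Lemma sumR_nonneg l f : (forall x, In x l -> 0 <= f x) -> 0 <= sumR l f.
Proof. intros H; rewrite <- (sumR_0 l (fun _ => 0)); auto. now apply sumR_le. Qed.

Lemma sumR_plus l f g : sumR l (fun x => f x + g x) = sumR l f + sumR l g.
Proof. induction l as [|a l IH]; simpl; [lra|]. rewrite IH; lra. Qed.

Lemma sumR_scal l c f : sumR l (fun x => c * f x) = c * sumR l f.
Proof. induction l as [|a l IH]; simpl; [lra|]. rewrite IH; lra. Qed.

Lemma sumR_app l l' f : sumR (l ++ l') f = sumR l f + sumR l' f.
Proof. induction l as [|a l IH]; simpl; [lra|]. rewrite IH; lra. Qed.

Lemma sumR_const l c : sumR l (fun _ => c) = INR (length l) * c.
Proof.
induction l as [|a l IH]; [simpl; lra|].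
change (length (a :: l)) with (S (length l)); rewrite S_INR; simpl; rewrite IH; lra.
Qed.
End Sums.

Lemma sumR_swap {A B : Type} (l : list A) (l' : list B) (f : A -> B -> R) :
  sumR l (fun x => sumR l' (f x)) = sumR l' (fun y => sumR l (fun x => f x y)).
Proof.
induction l as [|a l IH]; simpl; [now rewrite sumR_0|].
now rewrite IH, <- sumR_plus.
Qed.

Lemma sumR_map {A B : Type} (l : list A) (h : A -> B) (f : B -> R) :
  sumR (map h l) f = sumR l (fun x => f (h x)).
Proof. induction l as [|a l IH]; simpl; congruence. Qed.

Lemma sumR_delta (l : list nat) (k : nat) (f : nat -> R) : NoDup l -> In k l ->
  sumR l (fun w => (if Nat.eqb w k then 1 else 0) * f w) = f k.
Proof.
induction l as [|a l IH]; simpl; [tauto|].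
intros Hd [->|Hk]; inversion Hd; subst.
- rewrite Nat.eqb_refl, sumR_0; [lra|].
  intros x Hx. destruct (Nat.eqb_spec x k); subst; [tauto|lra].
- rewrite IH; auto. destruct (Nat.eqb_spec a k); subst; [tauto|lra].
Qed.

Lemma sumR_seq_S (N : nat) (f : nat -> R) :
  sumR (seq 0 (S N)) f = f 0%nat + sumR (seq 0 N) (fun t => f (S t)).
Proof. simpl. rewrite <- seq_shift, sumR_map. reflexivity. Qed.

Definition parity (n : nat) (f : nat -> bool) : bool :=
  fold_right (fun u acc => xorb (f u) acc) false (seq 0 n).

Lemma parity_flip (n k : nat) (b : bool) (f g : nat -> bool) : (k < n)%nat ->
  (forall u, g u = xorb (f u) (b && Nat.eqb u k)) -> parity n g = xorb (parity n f) b.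
Proof.
unfold parity; intros Hk H.
assert (G : forall l, NoDup l -> fold_right (fun u acc => xorb (g u) acc) false l =
   xorb (fold_right (fun u acc => xorb (f u) acc) false l)
        (b && existsb (fun u => Nat.eqb u k) l)).
{ induction l as [|a l IH]; intros Hd; simpl.
  - now rewrite andb_false_r.
  - inversion Hd; subst; rewrite IH; auto; rewrite H.
    destruct (Nat.eqb_spec a k); subst.
    + assert (E : existsb (fun u => Nat.eqb u k) l = false).
      { apply not_true_is_false; intros E; apply existsb_exists in E.
        destruct E as (x & Hx & E); apply Nat.eqb_eq in E; subst; tauto. }
      rewrite E; generalize (fold_right (fun u acc => xorb (f u) acc) false l).
      intros r; destruct b, (f k), r; reflexivity.
    + simpl; generalize (fold_right (fun u acc => xorb (f u) acc) false l).
      intros r; destruct b, (f a), r, (existsb _ _); reflexivity. }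
rewrite G by apply seq_NoDup. f_equal.
assert (E : existsb (fun u => Nat.eqb u k) (seq 0 n) = true).
{ apply existsb_exists; exists k; split; [apply in_seq; lia | apply Nat.eqb_refl]. }
rewrite E; apply andb_true_r.
Qed.

Lemma parity_ext (n : nat) (f g : nat -> bool) : (forall u, f u = g u) ->
  parity n f = parity n g.
Proof.
unfold parity; intros H; induction (seq 0 n); simpl; congruence.
Qed.

Lemma parity_false (n : nat) (f : nat -> bool) :
  (forall u, (u < n)%nat -> f u = false) -> parity n f = false.
Proof.
unfold parity; intros H.
assert (G : forall u, In u (seq 0 n) -> f u = false) by (intros; apply H; apply in_seq in H0; lia).
induction (seq 0 n) as [|a l IH]; simpl; auto.
rewrite G by (left; auto); rewrite IH; auto; intros; apply G; right; auto.
Qed.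

Lemma combine_tl_snoc (a w : nat) (h : list nat) :
  combine (a :: h ++ [w]) (h ++ [w]) = combine (a :: h) h ++ [(last (a :: h) 0%nat, w)].
Proof.
revert a; induction h as [|b h IH]; intros a; auto.
change ((b :: h) ++ [w]) with (b :: h ++ [w]).
change (combine (a :: b :: h ++ [w]) (b :: h ++ [w])) with ((a, b) :: combine (b :: h ++ [w]) (h ++ [w])).
rewrite IH. reflexivity.
Qed.

Lemma traversed_snoc (h : list nat) (w u v : nat) : h <> [] ->
  traversed (h ++ [w]) u v = traversed h u v ||
    ((Nat.eqb (current h) u && Nat.eqb w v) || (Nat.eqb (current h) v && Nat.eqb w u)).
Proof.
destruct h as [|a h]; [tauto|intros _].
unfold traversed, current.
change (tl ((a :: h) ++ [w])) with (h ++ [w]).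
change ((a :: h) ++ [w]) with (a :: h ++ [w]).
rewrite combine_tl_snoc, existsb_app. simpl existsb at 2.
now rewrite orb_false_r.
Qed.

Lemma traversed_sym (h : list nat) (u v : nat) : traversed h u v = traversed h v u.
Proof.
unfold traversed; induction (combine h (tl h)); simpl; auto.
rewrite IHl; f_equal; apply orb_comm.
Qed.

Lemma current_snoc (h : list nat) (w : nat) : current (h ++ [w]) = w.
Proof. apply last_last. Qed.

(** * The greedy walk that postpones its triangles *)

Section Rule.
Variables (n : nat) (adj tri : nat -> nat -> bool).

Definition unused_out (h : list nat) (v u : nat) : bool :=
  adj v u && negb (tri v u) && negb (traversed h v u).
Definition unused_tri (h : list nat) (v u : nat) : bool :=
  tri v u && negb (traversed h v u).

Definition next_unused (h : list nat) : option nat :=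
  match find (unused_out h (current h)) (seq 0 n) with
  | Some u => Some u
  | None => find (unused_tri h (current h)) (seq 0 n)
  end.

Definition lazy_rule (h : list nat) (w : nat) : R :=
  match next_unused h with
  | Some u => if Nat.eqb w u then 1 else 0
  | None => 0
  end.

Hypothesis adj_simple : simple_graph n adj.
Hypothesis tri_adj : forall u v, tri u v = true -> adj u v = true.
Hypothesis tri_sym : forall u v, tri u v = tri v u.

Variant next_spec (h : list nat) : option nat -> Prop :=
| NextOut w : (w < n)%nat -> unused_out h (current h) w = true -> next_spec h (Some w)
| NextTri w : (w < n)%nat -> (forall u, unused_out h (current h) u = false) ->
    unused_tri h (current h) w = true -> next_spec h (Some w)
| NextNone : (forall u, unused_out h (current h) u = false) ->
    (forall u, unused_tri h (current h) u = false) -> next_spec h None.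

Lemma adj_lt u v : adj u v = true -> (v < n)%nat.
Proof. destruct adj_simple as [H _]; intros E; apply H in E; tauto. Qed.

Lemma next_unusedP (h : list nat) : next_spec h (next_unused h).
Proof.
unfold next_unused.
destruct (find (unused_out h (current h)) (seq 0 n)) as [w|] eqn:E1.
- apply find_some in E1; destruct E1 as [H1 H2]; apply in_seq in H1.
  apply NextOut; auto; lia.
- assert (N1 : forall u, unused_out h (current h) u = false).
  { intros u; destruct (lt_dec u n) as [l|l].
    - apply (find_none _ _ E1); apply in_seq; lia.
    - unfold unused_out; destruct (adj (current h) u) eqn:Ea; auto; apply adj_lt in Ea; lia. }
  destruct (find (unused_tri h (current h)) (seq 0 n)) as [w|] eqn:E2.
  + apply find_some in E2; destruct E2 as [H1 H2]; apply in_seq in H1.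
    apply NextTri; auto; lia.
  + apply NextNone; auto.
    intros u; destruct (lt_dec u n) as [l|l].
    * apply (find_none _ _ E2); apply in_seq; lia.
    * unfold unused_tri; destruct (tri (current h) u) eqn:Ea; auto.
      apply tri_adj, adj_lt in Ea; lia.
Qed.

Lemma unused_out_adj h v u : unused_out h v u = true ->
  adj v u = true /\ tri v u = false /\ traversed h v u = false.
Proof.
unfold unused_out; destruct (adj v u), (tri v u), (traversed h v u); simpl; intuition congruence.
Qed.

Lemma unused_tri_adj h v u : unused_tri h v u = true ->
  tri v u = true /\ adj v u = true /\ traversed h v u = false.
Proof.
unfold unused_tri; destruct (tri v u) eqn:E; destruct (traversed h v u); simpl; intros; try discriminate.
apply tri_adj in E; auto.
Qed.

Lemma has_unused_next h : has_unused n adj h =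
  match next_unused h with Some _ => true | None => false end.
Proof.
unfold has_unused.
destruct (next_unusedP h) as [w Hw Hu|w Hw _ Hu|H1 H2].
- apply unused_out_adj in Hu; destruct Hu as (E1 & _ & E2).
  apply existsb_exists; exists w; rewrite in_seq, E1, E2; split; auto; lia.
- apply unused_tri_adj in Hu; destruct Hu as (_ & E1 & E2).
  apply existsb_exists; exists w; rewrite in_seq, E1, E2; split; auto; lia.
- apply not_true_is_false; intros E; apply existsb_exists in E.
  destruct E as (w & _ & E); specialize (H1 w); specialize (H2 w).
  unfold unused_out in H1; unfold unused_tri in H2.
  destruct (adj (current h) w), (tri (current h) w), (traversed h (current h) w); discriminate.
Qed.

Lemma lazy_rule_nonneg h w : 0 <= lazy_rule h w.
Proof. unfold lazy_rule; destruct (next_unused h) as [u|]; [destruct (Nat.eqb w u)|]; lra. Qed.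

Lemma lazy_rule_valid : valid_rule n adj lazy_rule.
Proof.
intros h; rewrite has_unused_next; intros E; split; [apply lazy_rule_nonneg|].
unfold lazy_rule; destruct (next_unusedP h) as [w Hw Hu|w Hw _ Hu|H1 H2]; try discriminate.
- split.
  + intros v Hv; destruct (Nat.eqb_spec v w); [subst|lra].
    apply unused_out_adj in Hu; tauto.
  + transitivity (sumR (seq 0 n) (fun v => (if Nat.eqb v w then 1 else 0) * 1)).
    * apply sumR_ext; intros; lra.
    * apply (sumR_delta _ _ (fun _ => 1)); [apply seq_NoDup | apply in_seq; lia].
- split.
  + intros v Hv; destruct (Nat.eqb_spec v w); [subst|lra].
    apply unused_tri_adj in Hu; tauto.
  + transitivity (sumR (seq 0 n) (fun v => (if Nat.eqb v w then 1 else 0) * 1)).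
    * apply sumR_ext; intros; lra.
    * apply (sumR_delta _ _ (fun _ => 1)); [apply seq_NoDup | apply in_seq; lia].
Qed.
End Rule.

(** * Greedy excursions and degree parities *)

Section Walk.
Variables (n d : nat) (adj tri : nat -> nat -> bool) (cell : nat -> nat).
Hypothesis adj_simple : simple_graph n adj.
Hypothesis adj_regular : regular n adj d.
Hypothesis tri_adj : forall u v, tri u v = true -> adj u v = true.
Hypothesis tri_sym : forall u v, tri u v = tri v u.
Hypothesis tri_cell : forall u v, tri u v = true -> cell u = cell v.
Hypothesis tri_even : forall v, (v < n)%nat -> parity n (tri v) = false.
Hypothesis out_even : forall v, (v < n)%nat ->
  parity n (fun u => adj v u && negb (tri v u)) = false.

Local Notation fresh_out := (unused_out adj tri).
Local Notation fresh_tri := (unused_tri tri).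
Local Notation rule := (lazy_rule n adj tri).

(* [z] is the vertex where the current trail of non-triangle edges began, [y]
   the vertex where the current trail of triangle edges began, which is also
   the vertex reached by the last random step; [W] lists the cells visited by
   random steps. *)
Record trail_inv (h : list nat) (z y : nat) (W : list nat) : Prop := TrailInv {
  inv_nonempty : h <> [];
  inv_current : (current h < n)%nat;
  inv_z : (z < n)%nat;
  inv_out : forall v, (v < n)%nat ->
    parity n (fresh_out h v) = xorb (Nat.eqb v (current h)) (Nat.eqb v z);
  inv_tri : forall v, (v < n)%nat ->
    parity n (fresh_tri h v) = xorb (Nat.eqb v z) (Nat.eqb v y);
  inv_cell : cell z = cell y;
  inv_visited : In (cell y) W;
  inv_traversed : forall u v, tri u v = true -> traversed h u v = true -> In (cell u) W
}.

Lemma adj_irrefl u : adj u u = false.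
Proof. destruct adj_simple as (_ & _ & H); apply H. Qed.
Lemma adj_sym u v : adj u v = adj v u.
Proof. destruct adj_simple as (_ & H & _); apply H. Qed.

Lemma trail_inv_init v : (v < n)%nat -> trail_inv [v] v v [cell v].
Proof.
intros Hv; constructor; auto; try discriminate.
- intros u Hu. change (current [v]) with v. rewrite xorb_nilpotent, <- (out_even u Hu).
  apply parity_ext; intros w; unfold unused_out; simpl; now rewrite andb_true_r.
- intros u Hu. rewrite xorb_nilpotent, <- (tri_even u Hu).
  apply parity_ext; intros w; unfold unused_tri; simpl; now rewrite andb_true_r.
- left; reflexivity.
Qed.

(** Handshake parity: an edge that appears or disappears changes the degree parity at its two ends
    and nowhere else. *)
Lemma parity_step (f g : nat -> nat -> bool) (x w v : nat) :
  (x < n)%nat -> (w < n)%nat -> x <> w ->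
  (forall u, g v u = xorb (f v u)
    (Nat.eqb v x && Nat.eqb u w || Nat.eqb v w && Nat.eqb u x)) ->
  parity n (g v) = xorb (parity n (f v)) (xorb (Nat.eqb v x) (Nat.eqb v w)).
Proof.
intros Hx Hw Hxw H.
destruct (Nat.eqb_spec v x) as [->|E1].
- destruct (Nat.eqb_spec x w) as [->|_]; [tauto|].
  apply (parity_flip n w true); auto.
  intros u; rewrite H; simpl; now rewrite orb_false_r.
- destruct (Nat.eqb_spec v w) as [->|E2].
  + now apply (parity_flip n x true).
  + rewrite xorb_false_r; apply parity_ext; intros u; rewrite H.
    simpl; apply xorb_false_r.
Qed.

Lemma step_edge_unused (h : list nat) (w v u : nat) (P : nat -> nat -> bool) :
  h <> [] -> (forall a b, P a b = P b a) -> P (current h) w = true ->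
  traversed h (current h) w = false -> current h <> w ->
  P v u && negb (traversed (h ++ [w]) v u) =
  xorb (P v u && negb (traversed h v u))
    (Nat.eqb v (current h) && Nat.eqb u w || Nat.eqb v w && Nat.eqb u (current h)).
Proof.
intros Hh Ps HP Ht Hn; rewrite traversed_snoc by auto.
rewrite (Nat.eqb_sym (current h) v), (Nat.eqb_sym (current h) u), (Nat.eqb_sym w u), (Nat.eqb_sym w v).
destruct (Nat.eqb_spec v (current h)) as [->|E1].
- destruct (Nat.eqb_spec (current h) w); [tauto|]; simpl.
  rewrite andb_false_r, !orb_false_r.
  destruct (Nat.eqb_spec u w) as [->|E2].
  + now rewrite HP, Ht.
  + now rewrite orb_false_r, xorb_false_r.
- simpl; destruct (Nat.eqb_spec v w) as [->|E2]; simpl.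
  + rewrite andb_true_r. destruct (Nat.eqb_spec u (current h)) as [->|E3].
    * rewrite (Ps w), HP, (traversed_sym _ w), Ht; reflexivity.
    * now rewrite orb_false_r, xorb_false_r.
  + now rewrite andb_false_r, orb_false_r, xorb_false_r.
Qed.

Lemma step_edge_other (h : list nat) (w v u : nat) (P : nat -> nat -> bool) :
  h <> [] -> (forall a b, P a b = P b a) ->
  P (current h) w = false \/ traversed h (current h) w = true ->
  P v u && negb (traversed (h ++ [w]) v u) = P v u && negb (traversed h v u).
Proof.
intros Hh Ps Hc; rewrite traversed_snoc by auto.
destruct (Nat.eqb (current h) v && Nat.eqb w u || Nat.eqb (current h) u && Nat.eqb w v) eqn:E;
  [|now rewrite orb_false_r].
assert (F : P v u = false \/ traversed h v u = true).
{ apply orb_prop in E; destruct E as [E|E]; apply andb_prop in E; destruct E as [E1 E2];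
  apply Nat.eqb_eq in E1, E2; rewrite <- E1, <- E2; auto.
  rewrite (Ps w), (traversed_sym _ w); auto. }
destruct F as [->| ->]; reflexivity.
Qed.

Definition out_edge (u v : nat) : bool := adj u v && negb (tri u v).

Lemma out_edge_sym u v : out_edge u v = out_edge v u.
Proof. unfold out_edge; now rewrite adj_sym, tri_sym. Qed.

Lemma trail_inv_out h z y W w : trail_inv h z y W -> (w < n)%nat ->
  fresh_out h (current h) w = true -> trail_inv (h ++ [w]) z y W.
Proof.
intros [H1 H2 H3 H4 H5 H6 H7 H8] Hw Hu.
destruct (unused_out_adj _ _ _ _ _ Hu) as (Ea & Et & Etr).
assert (Hn : current h <> w) by (intros E; rewrite <- E, adj_irrefl in Ea; discriminate).
constructor; auto.
- now destruct h.
- now rewrite current_snoc.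
- intros v Hv; rewrite current_snoc.
  rewrite (parity_step (fresh_out h) (fresh_out (h ++ [w])) (current h) w v); auto.
  + rewrite H4 by auto.
    destruct (Nat.eqb v (current h)), (Nat.eqb v z), (Nat.eqb v w); reflexivity.
  + intros u; apply (step_edge_unused h w v u out_edge); auto using out_edge_sym.
    unfold out_edge; now rewrite Ea, Et.
- intros v Hv; rewrite <- (H5 v Hv); apply parity_ext; intros u.
  apply (step_edge_other h w v u tri); auto.
- intros u v Huv; rewrite traversed_snoc by auto; intros E.
  apply orb_prop in E; destruct E as [E|E]; [eapply H8; eauto|].
  exfalso. assert (F : tri (current h) w = true); [|congruence].
  apply orb_prop in E; destruct E as [E|E]; apply andb_prop in E; destruct E as [E1 E2];
  apply Nat.eqb_eq in E1, E2; subst; auto. now rewrite tri_sym.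
Qed.

Lemma exhausted_out h z y W : trail_inv h z y W ->
  (forall u, fresh_out h (current h) u = false) -> current h = z.
Proof.
intros I H; pose proof (inv_out _ _ _ _ I (current h) (inv_current _ _ _ _ I)) as E.
rewrite parity_false, Nat.eqb_refl in E by auto.
destruct (Nat.eqb_spec (current h) z); auto; discriminate.
Qed.

Lemma exhausted_tri h z y W : trail_inv h z y W -> current h = z ->
  (forall u, fresh_tri h (current h) u = false) -> z = y.
Proof.
intros I Ez H; pose proof (inv_tri _ _ _ _ I (current h) (inv_current _ _ _ _ I)) as E.
rewrite parity_false, Ez, Nat.eqb_refl in E by auto.
destruct (Nat.eqb_spec z y); auto; discriminate.
Qed.

(** The trail of other edges has closed up at [z], so an empty one starts at [w], and the triangle
    trail from [y] grows by one edge. It stays in the cell of [y], which is already in [W]: a greedy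
    step never records a new cell. *)
Lemma trail_inv_tri h z y W w : trail_inv h z y W -> (w < n)%nat ->
  (forall u, fresh_out h (current h) u = false) ->
  fresh_tri h (current h) w = true -> trail_inv (h ++ [w]) w y W.
Proof.
intros I Hw Hex Hu; pose proof (exhausted_out _ _ _ _ I Hex) as Ez.
destruct I as [H1 H2 H3 H4 H5 H6 H7 H8].
destruct (unused_tri_adj _ _ tri_adj _ _ _ Hu) as (Et & Ea & Etr).
assert (Hn : current h <> w) by (intros E; rewrite <- E, adj_irrefl in Ea; discriminate).
assert (Hc : cell w = cell y) by (rewrite <- H6, <- Ez; symmetry; auto).
constructor; auto.
- now destruct h.
- now rewrite current_snoc.
- intros v Hv; rewrite current_snoc, xorb_nilpotent.
  transitivity (parity n (fresh_out h v)).
  + apply parity_ext; intros u; apply (step_edge_other h w v u out_edge); auto using out_edge_sym.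
    left; unfold out_edge; now rewrite Et, andb_false_r.
  + rewrite H4, Ez by auto; apply xorb_nilpotent.
- intros v Hv.
  rewrite (parity_step (fresh_tri h) (fresh_tri (h ++ [w])) (current h) w v); auto.
  + rewrite H5, Ez by auto.
    destruct (Nat.eqb v z), (Nat.eqb v y), (Nat.eqb v w); reflexivity.
  + intros u; apply (step_edge_unused h w v u tri); auto.
- intros u v Huv; rewrite traversed_snoc by auto; intros E.
  apply orb_prop in E; destruct E as [E|E]; [eapply H8; eauto|].
  assert (F : cell u = cell y); [|now rewrite F].
  apply orb_prop in E; destruct E as [E|E]; apply andb_prop in E; destruct E as [E1 E2];
  apply Nat.eqb_eq in E1, E2; subst; congruence.
Qed.

(** Both trails are closed here and all edges at the current vertex are used, so the random step
    changes no parity, and [w] becomes the origin of two empty trails. *)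
Lemma trail_inv_random h z y W w : trail_inv h z y W ->
  (forall u, fresh_out h (current h) u = false) ->
  (forall u, fresh_tri h (current h) u = false) ->
  adj (current h) w = true -> trail_inv (h ++ [w]) w w (cell w :: W).
Proof.
intros I Hex Hex' Ea; pose proof (exhausted_out _ _ _ _ I Hex) as Ez.
pose proof (exhausted_tri _ _ _ _ I Ez Hex') as Ey.
destruct I as [H1 H2 H3 H4 H5 H6 H7 H8].
assert (Hw : (w < n)%nat) by (destruct adj_simple as (H & _); apply H in Ea; tauto).
assert (Htr : traversed h (current h) w = true).
{ specialize (Hex w); specialize (Hex' w); unfold unused_out, unused_tri in *.
  destruct (adj (current h) w), (tri (current h) w), (traversed h (current h) w); auto; discriminate. }
constructor; auto.
- now destruct h.
- now rewrite current_snoc.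
- intros v Hv; rewrite current_snoc, xorb_nilpotent.
  transitivity (parity n (fresh_out h v)).
  + apply parity_ext; intros u; apply (step_edge_other h w v u out_edge); auto using out_edge_sym.
  + rewrite H4, Ez by auto; apply xorb_nilpotent.
- intros v Hv; rewrite xorb_nilpotent.
  transitivity (parity n (fresh_tri h v)).
  + apply parity_ext; intros u; apply (step_edge_other h w v u tri); auto.
  + rewrite H5, Ey by auto; apply xorb_nilpotent.
- left; reflexivity.
- intros u v Huv; rewrite traversed_snoc by auto; intros E; right.
  apply orb_prop in E; destruct E as [E|E]; [eapply H8; eauto|].
  apply (H8 u v); auto.
  apply orb_prop in E; destruct E as [E|E]; apply andb_prop in E; destruct E as [E1 E2];
  apply Nat.eqb_eq in E1, E2; subst; auto. now rewrite traversed_sym.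
Qed.

(** * Lower bounds on the cover time from a potential *)

Section Potential.
Variables (Psi : nat -> list nat -> R) (M : R).
Hypothesis Psi_le : forall x W, Psi x W <= M.
Hypothesis Psi_visited : forall x W,
  (forall u v, tri u v = true -> In (cell u) W) -> Psi x W <= 0.
Hypothesis Psi_step : forall x W, (x < n)%nat -> In (cell x) W ->
  Psi x W <= 1 + sumR (seq 0 n) (fun w => (if adj x w then / INR d else 0) * Psi w (cell w :: W)).
Hypothesis M_pos : 0 < M.

Local Notation tail := (not_covered_prob n adj rule).

Lemma grw_step_nonneg h w : 0 <= grw_step n adj rule h w.
Proof.
unfold grw_step; destruct (has_unused n adj h); [apply lazy_rule_nonneg|].
destruct (adj (current h) w) eqn:Ea; [|lra].
destruct (deg n adj (current h)) eqn:E; [simpl; rewrite Rinv_0; lra|].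
apply Rlt_le, Rinv_0_lt_compat, lt_0_INR; lia.
Qed.

Lemma tail_nonneg t : forall h, 0 <= tail h t.
Proof.
induction t as [|t IH]; intros h; simpl.
- destruct (all_covered n adj h); lra.
- apply sumR_nonneg; intros; apply Rmult_le_pos; auto using grw_step_nonneg.
Qed.

Lemma all_covered_traversed h u v : all_covered n adj h = true -> adj u v = true ->
  traversed h u v = true.
Proof.
intros H Ea; unfold all_covered in H; rewrite forallb_forall in H.
destruct adj_simple as (Hs & _); destruct (Hs _ _ Ea) as [Hu Hv].
assert (Iu : In u (seq 0 n)) by (apply in_seq; lia).
assert (Iv : In v (seq 0 n)) by (apply in_seq; lia).
specialize (H u Iu); rewrite forallb_forall in H; specialize (H v Iv).
now rewrite Ea in H.
Qed.

(** Optional stopping at the finite horizon [N]: the term [M * tail h N] pays for the walks that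
    have not covered the graph by then. A greedy step leaves [y] and [W], hence the potential,
    unchanged, and its unit of time is a gain; only a random step calls on [Psi_step]. Once all
    edges are covered, the left side is at most 0. *)
Lemma potential_le_tails N : forall h z y W, trail_inv h z y W ->
  Psi y W <= sumR (seq 0 N) (tail h) + M * tail h N.
Proof.
induction N as [|N IH]; intros h z y W I.
- simpl; destruct (all_covered n adj h) eqn:E; [|specialize (Psi_le y W); lra].
  enough (Psi y W <= 0) by lra.
  apply Psi_visited; intros u v Ht; apply (inv_traversed _ _ _ _ I u v); auto.
  now apply all_covered_traversed; auto.
- assert (NN : 0 <= sumR (seq 0 (S N)) (tail h) + M * tail h (S N)).
  { apply Rplus_le_le_0_compat; [apply sumR_nonneg; intros; apply tail_nonneg|].
    apply Rmult_le_pos; [lra|apply tail_nonneg]. }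
  destruct (all_covered n adj h) eqn:Ec.
  { apply Rle_trans with (2 := NN); apply Psi_visited; intros u v Ht.
    apply (inv_traversed _ _ _ _ I u v); auto. now apply all_covered_traversed; auto. }
  clear NN.
  assert (E : sumR (seq 0 (S N)) (tail h) + M * tail h (S N) =
     1 + sumR (seq 0 n) (fun w => grw_step n adj rule h w *
        (sumR (seq 0 N) (tail (h ++ [w])) + M * tail (h ++ [w]) N))).
  { rewrite sumR_seq_S. simpl tail at 1. rewrite Ec, Rplus_assoc; f_equal.
    simpl tail. rewrite sumR_swap, <- sumR_scal, <- sumR_plus.
    apply sumR_ext; intros w _. rewrite sumR_scal; ring. }
  rewrite E; clear E.
  pose proof (inv_current _ _ _ _ I) as Hx.
  unfold grw_step; rewrite (has_unused_next n adj tri adj_simple tri_adj); unfold lazy_rule.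
  destruct (next_unusedP n adj tri adj_simple tri_adj h) as [w Hw Hu|w Hw Hex Hu|Hex Hex'].
  + rewrite (sumR_delta _ w (fun w => sumR (seq 0 N) (tail (h ++ [w])) + M * tail (h ++ [w]) N));
      [|apply seq_NoDup|apply in_seq; lia].
    pose proof (IH _ _ _ _ (trail_inv_out _ _ _ _ _ I Hw Hu)); lra.
  + rewrite (sumR_delta _ w (fun w => sumR (seq 0 N) (tail (h ++ [w])) + M * tail (h ++ [w]) N));
      [|apply seq_NoDup|apply in_seq; lia].
    pose proof (IH _ _ _ _ (trail_inv_tri _ _ _ _ _ I Hw Hex Hu)); lra.
  + pose proof (exhausted_out _ _ _ _ I Hex) as Ez.
    pose proof (exhausted_tri _ _ _ _ I Ez Hex') as Ey.
    assert (Exy : current h = y) by congruence.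
    rewrite (adj_regular _ Hx).
    apply Rle_trans with (1 := Psi_step y W ltac:(now rewrite <- Exy) (inv_visited _ _ _ _ I)).
    apply Rplus_le_compat_l, sumR_le; intros w _.
    rewrite <- Exy.
    destruct (adj (current h) w) eqn:Ea; [|lra].
    apply Rmult_le_compat_l.
    * destruct d; [simpl; rewrite Rinv_0; lra|].
      apply Rlt_le, Rinv_0_lt_compat, lt_0_INR; lia.
    * apply (IH _ w w); eapply trail_inv_random; eauto.
Qed.

Theorem cover_time_ge_potential v : (v < n)%nat ->
  expected_cover_time_ge n adj rule v (Psi v [cell v]).
Proof.
intros Hv y Hy.
pose proof (fun N => potential_le_tails N _ _ _ _ (trail_inv_init v Hv)) as H.
set (eta := Psi v [cell v] - y).
assert (He : 0 < eta / M) by (apply Rdiv_lt_0_compat; unfold eta; lra).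
(* Either some partial sum reaches [y], or every tail is at least [eta / M] and the partial sums are
   unbounded; no convergence of the tails to 0 is assumed. *)
assert (D : forall N, y <= sumR (seq 0 N) (tail [v]) \/ eta / M <= tail [v] N).
{ intros N; destruct (Rle_dec y (sumR (seq 0 N) (tail [v]))); [now left|right].
  apply (Rmult_le_reg_l M); auto.
  replace (M * (eta / M)) with eta by (field; lra).
  specialize (H N); unfold eta; lra. }
assert (G : forall N, (exists N', y <= sumR (seq 0 N') (tail [v])) \/
   INR N * (eta / M) <= sumR (seq 0 N) (tail [v])).
{ induction N as [|N [IH|IH]]; [right; simpl; lra|now left|].
  destruct (D N) as [HN|HN]; [left; eauto|right].
  rewrite seq_S, sumR_app, S_INR; simpl sumR; simpl Nat.add; lra. }
destruct (INR_unbounded (y / (eta / M))) as [N HN].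
destruct (G N) as [[N' HN']|HN']; [exists N'; exact HN'|exists N].
apply Rle_trans with (2 := HN'); apply Rlt_le.
apply (Rmult_lt_compat_r (eta / M)) in HN; auto.
replace (y / (eta / M) * (eta / M)) with y in HN by (field; split; unfold eta; lra).
exact HN.
Qed.
End Potential.
End Walk.

(** * Coupon-collector potential *)

Definition harmonic (j : nat) : R := sumR (seq 0 j) (fun i => / INR (S i)).

Lemma harmonic_S j : harmonic (S j) = harmonic j + / INR (S j).
Proof.
unfold harmonic; rewrite seq_S, sumR_app, Nat.add_0_l.
unfold sumR at 2; cbn [fold_right]; lra.
Qed.

Lemma harmonic_mono i j : (i <= j)%nat -> harmonic i <= harmonic j.
Proof.
induction 1 as [|j _ IH]; [lra|rewrite harmonic_S].
assert (0 < / INR (S j)) by (apply Rinv_0_lt_compat, lt_0_INR; lia); lra.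
Qed.

Lemma ln_le_harmonic j : ln (INR (S j)) <= harmonic j.
Proof.
induction j as [|j IH]; [simpl; rewrite ln_1; unfold harmonic; simpl; lra|].
rewrite harmonic_S.
assert (P : 0 < INR (S j)) by (apply lt_0_INR; lia).
assert (Q : 0 < / INR (S j)) by (now apply Rinv_0_lt_compat).
replace (INR (S (S j))) with (INR (S j) * (1 + / INR (S j))) by (rewrite (S_INR (S j)); field; lra).
rewrite ln_mult by lra.
assert (ln (1 + / INR (S j)) <= / INR (S j)); [|lra].
apply Rnot_lt_le; intros H; apply exp_increasing in H; rewrite exp_ln in H by lra.
pose proof (exp_ineq1_le (/ INR (S j))); lra.
Qed.

Lemma sumR_remove (a : nat) (l : list nat) (f : nat -> R) : NoDup l -> In a l ->
  sumR l f = f a + sumR (filter (fun b => negb (Nat.eqb b a)) l) f /\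
  length l = S (length (filter (fun b => negb (Nat.eqb b a)) l)).
Proof.
induction l as [|b l IH]; simpl; [tauto|intros Hd [->|Ha]]; inversion Hd; subst.
- rewrite Nat.eqb_refl; simpl.
  assert (E : filter (fun b => negb (Nat.eqb b a)) l = l).
  { apply forallb_filter_id, forallb_forall; intros x Hx.
    destruct (Nat.eqb_spec x a); subst; tauto. }
  now rewrite E.
- destruct (IH H2 Ha) as [E1 E2]; destruct (Nat.eqb_spec b a) as [->|_]; [tauto|simpl].
  rewrite E1, E2; split; [ring|reflexivity].
Qed.

Section Coupon.
Variables (n d : nat) (adj tri : nat -> nat -> bool) (cell : nat -> nat).
Hypothesis adj_simple : simple_graph n adj.
Hypothesis adj_regular : regular n adj d.
Hypothesis d_pos : (0 < d)%nat.
Variables (K : list nat) (gamma : nat -> nat -> R) (kappa : R).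
Hypothesis K_NoDup : NoDup K.
Hypothesis kappa_pos : 0 < kappa.
Hypothesis K_tri : forall a, In a K -> exists u v, tri u v = true /\ cell u = a.
Hypothesis gamma_nonneg : forall a x, 0 <= gamma a x.

Definition srw (f : nat -> R) (x : nat) : R :=
  sumR (seq 0 n) (fun w => (if adj x w then / INR d else 0) * f w).

Hypothesis gamma_in : forall w, (w < n)%nat -> 1 <= gamma (cell w) w.
Hypothesis gamma_step : forall a x, (x < n)%nat -> In a K -> cell x <> a ->
  srw (gamma a) x <= gamma a x + kappa.
Hypothesis gamma_sep : forall a w, (w < n)%nat -> In a K -> In (cell w) K -> cell w <> a ->
  gamma a w <= 1 / 2.

Definition unvisited (W : list nat) : list nat :=
  filter (fun a => negb (existsb (Nat.eqb a) W)) K.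

Definition coupon_potential (x : nat) (W : list nat) : R :=
  / (2 * kappa) * harmonic (length (unvisited W))
  - / (kappa * INR (length (unvisited W))) * sumR (unvisited W) (fun a => gamma a x).

Lemma in_unvisited a W : In a (unvisited W) <-> In a K /\ ~ In a W.
Proof.
unfold unvisited; rewrite filter_In, negb_true_iff, <- not_true_iff_false, existsb_exists.
split; intros [H1 H2]; split; auto; intros H; apply H2.
- exists a; rewrite Nat.eqb_refl; auto.
- destruct H as (b & Hb & E); apply Nat.eqb_eq in E; now subst.
Qed.

Lemma unvisited_cons a W :
  unvisited (a :: W) = filter (fun b => negb (Nat.eqb b a)) (unvisited W).
Proof.
unfold unvisited; generalize K as l; induction l as [|b l IH]; simpl; auto.
simpl in IH; destruct (existsb (Nat.eqb b) W); rewrite ?orb_true_r, ?orb_false_r; simpl; auto.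
destruct (Nat.eqb b a); simpl; now rewrite IH.
Qed.

Lemma unvisited_NoDup W : NoDup (unvisited W).
Proof. now apply NoDup_filter. Qed.

Lemma Rinv_nonneg x : 0 <= x -> 0 <= / x.
Proof. intros [H| <-]; [left; now apply Rinv_0_lt_compat|rewrite Rinv_0; lra]. Qed.

Lemma coupon_potential_le x W :
  coupon_potential x W <= / (2 * kappa) * harmonic (length K) + 1.
Proof.
unfold coupon_potential.
assert (H1 : harmonic (length (unvisited W)) <= harmonic (length K)).
{ apply harmonic_mono, filter_length_le. }
assert (H2 : 0 <= / (kappa * INR (length (unvisited W))) * sumR (unvisited W) (fun a => gamma a x)).
{ apply Rmult_le_pos.
  - apply Rinv_nonneg, Rmult_le_pos; [lra|apply pos_INR].
  - apply sumR_nonneg; auto. }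
assert (H3 : 0 < / (2 * kappa)) by (apply Rinv_0_lt_compat; lra).
nra.
Qed.

Lemma coupon_potential_visited x W :
  (forall u v, tri u v = true -> In (cell u) W) -> coupon_potential x W <= 0.
Proof.
intros H; unfold coupon_potential.
assert (E : unvisited W = []).
{ destruct (unvisited W) as [|a l] eqn:E; auto.
  assert (Ha : In a (unvisited W)) by (rewrite E; left; auto).
  apply in_unvisited in Ha; destruct Ha as [Ha Hn].
  destruct (K_tri _ Ha) as (u & v & Ht & <-); exfalso; apply Hn; eauto. }
rewrite E; unfold harmonic; simpl; lra.
Qed.

(* The choice of the coefficients makes the drop of the harmonic term compensate
   the removal of the newly visited cell. *)
Lemma coupon_potential_new w W : (w < n)%nat ->
  / (2 * kappa) * harmonic (length (unvisited W))
  - / (kappa * INR (length (unvisited W))) * sumR (unvisited W) (fun a => gamma a w)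
  <= coupon_potential w (cell w :: W).
Proof.
intros Hw; unfold coupon_potential; rewrite unvisited_cons.
set (U := unvisited W); set (a := cell w).
destruct (in_dec Nat.eq_dec a U) as [Ha|Ha].
- destruct (sumR_remove a U (fun b => gamma b w) (unvisited_NoDup W) Ha) as [-> E].
  rewrite !E; set (U' := filter (fun b => negb (Nat.eqb b a)) U) in *.
  rewrite harmonic_S; set (j := length U').
  assert (Ga : 1 <= gamma a w) by (now apply gamma_in).
  assert (S' : sumR U' (fun b => gamma b w) <= INR j * (1 / 2)).
  { unfold j; rewrite <- sumR_const; apply sumR_le; intros b Hb.
    apply filter_In in Hb; destruct Hb as [Hb Hba].
    apply in_unvisited in Hb; apply in_unvisited in Ha.
    apply gamma_sep; try tauto.
    intros E'; fold a in E'; rewrite E', Nat.eqb_refl in Hba; discriminate. }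
  set (s := sumR U' (fun b => gamma b w)) in *.
  assert (s0 : 0 <= s) by (apply sumR_nonneg; auto).
  assert (J : 0 < INR (S j)) by (apply lt_0_INR; lia).
  assert (K0 : 0 < / kappa) by (now apply Rinv_0_lt_compat).
  assert (J0 : 0 < / INR (S j)) by (now apply Rinv_0_lt_compat).
  rewrite !Rinv_mult.
  enough (/ 2 * / INR (S j) <= / INR (S j) * (gamma a w + s) - / INR j * s) by nra.
  destruct (Nat.eq_dec j 0) as [E0|N0].
  + rewrite E0 in *; simpl in *. assert (s = 0) by lra. rewrite Rinv_1; nra.
  + assert (Jp : 0 < INR j) by (apply lt_0_INR; lia).
    assert (Js : / INR j * s <= / INR (S j) * s + / 2 * / INR (S j)).
    { replace (/ INR j * s) with (/ INR (S j) * s + / INR (S j) * (/ INR j * s)).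
      - assert (/ INR j * s <= / 2); [|nra].
        apply (Rmult_le_reg_l (INR j)); auto.
        rewrite <- Rmult_assoc, Rinv_r by lra; lra.
      - rewrite S_INR in *; field; lra. }
    nra.
- assert (E : filter (fun b => negb (Nat.eqb b a)) U = U).
  { apply forallb_filter_id, forallb_forall; intros b Hb.
    destruct (Nat.eqb_spec b a); subst; tauto. }
  rewrite E; lra.
Qed.

Lemma srw_const c x : (x < n)%nat -> srw (fun _ => c) x = c.
Proof.
intros Hx; unfold srw.
assert (E : forall l, sumR l (fun w => (if adj x w then / INR d else 0) * c) =
   INR (length (filter (adj x) l)) * (/ INR d * c)).
{ induction l as [|w l IH]; [simpl; lra|].
  simpl sumR; rewrite IH; simpl filter; destruct (adj x w); [|lra].
  change (length (w :: filter (adj x) l)) with (S (length (filter (adj x) l))); rewrite S_INR; lra. }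
rewrite E; pose proof (adj_regular x Hx) as D; unfold deg, neighbors in D; rewrite D.
field; apply not_0_INR; lia.
Qed.

Lemma srw_le f g x : (forall w, (w < n)%nat -> f w <= g w) -> srw f x <= srw g x.
Proof.
intros H; apply sumR_le; intros w Hw; apply in_seq in Hw.
apply Rmult_le_compat_l; [|apply H; lia].
destruct (adj x w); [apply Rinv_nonneg, pos_INR|lra].
Qed.

Lemma srw_affine c e (L : list nat) (f : nat -> nat -> R) x : (x < n)%nat ->
  srw (fun w => c - e * sumR L (fun a => f a w)) x = c - e * sumR L (fun a => srw (f a) x).
Proof.
intros Hx. transitivity (srw (fun _ => c) x - e * sumR L (fun a => srw (f a) x));
  [|now rewrite (srw_const c x Hx)].
unfold srw; rewrite sumR_swap, <- sumR_scal.
match goal with |- _ = ?u - ?v => replace (u - v) with (u + (-1) * v) by ring end.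
rewrite <- sumR_scal, <- sumR_plus; apply sumR_ext; intros w _.
rewrite sumR_scal; ring.
Qed.

(** As the cell of [x] is visited, [x] lies in no unvisited cell, so each of the [j] Green functions
    grows by at most [kappa] in mean, and the coefficient [1 / (kappa j)] turns the total into 1.
    The update of the visited set at the next vertex is absorbed by [coupon_potential_new]. *)
Lemma coupon_potential_step x W : (x < n)%nat -> In (cell x) W ->
  coupon_potential x W <= 1 + srw (fun w => coupon_potential w (cell w :: W)) x.
Proof.
intros Hx Hc.
eapply Rle_trans; [|apply Rplus_le_compat_l, srw_le; intros w Hw; now apply coupon_potential_new].
rewrite srw_affine by auto; unfold coupon_potential.
set (U := unvisited W).
assert (S' : sumR U (fun a => srw (gamma a) x) <= sumR U (fun a => gamma a x) + INR (length U) * kappa).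
{ rewrite <- sumR_const, <- sumR_plus; apply sumR_le; intros a Ha.
  apply in_unvisited in Ha; apply gamma_step; try tauto; intros <-; tauto. }
destruct (Nat.eq_dec (length U) 0) as [E|E].
- apply length_zero_iff_nil in E; rewrite E; simpl; lra.
- assert (P : 0 < INR (length U)) by (apply lt_0_INR; lia).
  assert (Q : 0 < / (kappa * INR (length U))) by (apply Rinv_0_lt_compat, Rmult_lt_0_compat; lra).
  assert (E1 : / (kappa * INR (length U)) * (INR (length U) * kappa) = 1) by (field; lra).
  nra.
Qed.

Hypothesis tri_adj : forall u v, tri u v = true -> adj u v = true.
Hypothesis tri_sym : forall u v, tri u v = tri v u.
Hypothesis tri_cell : forall u v, tri u v = true -> cell u = cell v.
Hypothesis tri_even : forall v, (v < n)%nat -> parity n (tri v) = false.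
Hypothesis out_even : forall v, (v < n)%nat ->
  parity n (fun u => adj v u && negb (tri v u)) = false.

Theorem cover_time_ge_coupon v : (v < n)%nat -> In (cell v) K ->
  expected_cover_time_ge n adj (lazy_rule n adj tri) v
    (/ (2 * kappa) * (ln (INR (length K)) - 1)).
Proof.
intros Hv HK.
assert (H : expected_cover_time_ge n adj (lazy_rule n adj tri) v (coupon_potential v [cell v])).
{ apply (cover_time_ge_potential n d adj tri cell) with
    (M := / (2 * kappa) * harmonic (length K) + 1); auto.
  - apply coupon_potential_le.
  - apply coupon_potential_visited.
  - apply coupon_potential_step.
  - assert (0 <= harmonic (length K)).
    { apply sumR_nonneg; intros; apply Rinv_nonneg, pos_INR. }
    assert (0 < / (2 * kappa)) by (apply Rinv_0_lt_compat; lra). nra. }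
intros y Hy; apply H; apply Rlt_le_trans with (1 := Hy).
unfold coupon_potential; rewrite unvisited_cons.
assert (E0 : unvisited [] = K).
{ apply forallb_filter_id, forallb_forall; auto. }
rewrite E0.
destruct (sumR_remove (cell v) K (fun b => gamma b v) K_NoDup HK) as [_ E].
rewrite E; set (U := filter (fun b => negb (Nat.eqb b (cell v))) K).
assert (S' : sumR U (fun b => gamma b v) <= INR (length U) * (1 / 2)).
{ rewrite <- sumR_const; apply sumR_le; intros b Hb.
  apply filter_In in Hb; destruct Hb as [Hb Hba]; apply gamma_sep; auto.
  intros E'; rewrite E', Nat.eqb_refl in Hba; discriminate. }
assert (K0 : 0 < / kappa) by (now apply Rinv_0_lt_compat).
pose proof (ln_le_harmonic (length U)) as Hl.
set (s := sumR U (fun b => gamma b v)) in *.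
rewrite !Rinv_mult.
(* By separation the Green functions of the remaining cells have mean at most 1/2 at [v]; this
   accounts for the 1 subtracted from the logarithm. *)
enough (/ INR (length U) * s <= / 2) by nra.
destruct (Nat.eq_dec (length U) 0) as [E1|E1].
- rewrite E1; simpl (INR 0); rewrite Rinv_0; lra.
- assert (P : 0 < INR (length U)) by (apply lt_0_INR; lia).
  apply (Rmult_le_reg_l (INR (length U))); auto.
  rewrite <- Rmult_assoc, Rinv_r by lra; lra.
Qed.
End Coupon.

(** * Numerical estimates *)

Lemma geometric_beats_square (l : R) : 0 < l < 1 ->
  exists p0 : nat, forall p, (p0 <= p)%nat -> l ^ p * (15 * INR p ^ 2) <= 1.
Proof.
intros [l0 l1].
set (y := - ln l).
assert (y0 : 0 < y) by (unfold y; pose proof (ln_increasing l 1 l0 l1) as H; rewrite ln_1 in H; lra).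
(* [405 = 15 * 27]: the exponential of [y p] is bounded below by the cube of [y p / 3], which costs
   the 27, and [15 p^2] bounds the number of vertices. *)
destruct (INR_unbounded (405 / y ^ 3)) as [p0 Hp0].
exists (S p0); intros p Hp.
assert (P : 0 < INR p) by (apply lt_0_INR; lia).
assert (P0 : INR p0 <= INR p) by (apply le_INR; lia).
assert (y3 : 0 < y ^ 3) by (apply pow_lt; lra).
assert (Q : 405 <= INR p * y ^ 3).
{ apply (Rmult_lt_compat_r (y ^ 3)) in Hp0; auto.
  replace (405 / y ^ 3 * y ^ 3) with 405 in Hp0 by (field; lra). nra. }
assert (E : l ^ p * exp (y * INR p) = 1).
{ rewrite <- (exp_ln l) at 1 by auto. rewrite <- Rpower_pow by apply exp_pos.
  unfold Rpower; rewrite ln_exp, <- exp_plus.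
  replace (INR p * ln l + y * INR p) with 0 by (unfold y; ring). apply exp_0. }
assert (F : 15 * INR p ^ 2 <= exp (y * INR p)).
{ replace (y * INR p) with (y * INR p / 3 + (y * INR p / 3 + y * INR p / 3)) by field.
  rewrite !exp_plus.
  pose proof (exp_ineq1_le (y * INR p / 3)) as H.
  set (t := y * INR p / 3) in *; set (x := exp t) in *.
  assert (t0 : 0 < t) by (unfold t; apply Rdiv_lt_0_compat; nra).
  apply Rle_trans with (t * (t * t)).
  - unfold t; replace (y * INR p / 3 * (y * INR p / 3 * (y * INR p / 3)))
      with (INR p ^ 2 * (INR p * y ^ 3) / 27) by field.
    assert (0 < INR p ^ 2) by (apply pow_lt; lra). nra.
  - apply Rmult_le_compat; [lra|nra|lra|]. apply Rmult_le_compat; lra. }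
assert (0 < l ^ p) by (apply pow_lt; auto).
rewrite <- E; nra.
Qed.

Lemma ln_le_sub1 x : 0 < x -> ln x <= x - 1.
Proof.
intros Hx; apply Rnot_lt_le; intros H; apply exp_increasing in H; rewrite exp_ln in H by auto.
pose proof (exp_ineq1_le (x - 1)); lra.
Qed.

Lemma ln_le_mono x y : 0 < x -> x <= y -> ln x <= ln y.
Proof. intros Hx [H| <-]; [left; now apply ln_increasing | right; auto]. Qed.

(** The induced cycles have 5 vertices in each of [p] cells. Their length is of the order of the
    square root of [n], so the crude [ln x <= x - 1] suffices and epsilon can be 1. *)
Lemma ln_le_cycle (n p : nat) : (0 < n)%nat -> (n <= 15 * p ^ 2)%nat -> (5 <= p)%nat ->
  ln (INR n) <= INR (5 * p).
Proof.
intros n0 np p5.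
assert (N : 0 < INR n) by (apply lt_0_INR; lia).
assert (P : 5 <= INR p) by (apply le_INR in p5; simpl in p5; lra).
assert (H : INR n <= 15 * (INR p * INR p)).
{ apply le_INR in np; simpl (_ ^ _)%nat in np; rewrite !mult_INR in np; simpl in np; lra. }
apply Rle_trans with (ln (15 * (INR p * INR p))); [now apply ln_le_mono|].
rewrite !ln_mult by nra.
pose proof (ln_le_sub1 15 ltac:(lra)); pose proof (ln_le_sub1 (INR p) ltac:(lra)).
rewrite mult_INR; simpl; lra.
Qed.

(** Since [30 p + 1 <= 31 p], the number [m] of kept cells is at least [p / 31], so
    [n <= 15 * 31^2 * m^2 = 14415 m^2]. The lower bound on [ln n] then yields
    [ln m - 1 >= ln n / 4], and [1/152] is a quarter of the [1/38] that comes from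
    [kappa = 19 / n]. *)
Lemma coupon_bound (n p m : nat) :
  (0 < n)%nat -> (n <= 15 * p ^ 2)%nat -> (1 <= p)%nat -> (p ^ 2 <= m * S (30 * p))%nat ->
  2 * ln 14415 + 4 <= ln (INR n) ->
  / 152 * INR n * ln (INR n) <= / (2 * (INR 19 / INR n)) * (ln (INR m) - 1).
Proof.
intros n0 np p1 pm L.
simpl (_ ^ _)%nat in pm; rewrite Nat.mul_1_r in pm.
assert (pm' : (p <= 31 * m)%nat).
{ apply (Nat.mul_le_mono_pos_l _ _ p); [lia|].
  apply Nat.le_trans with (1 := pm).
  replace (p * (31 * m))%nat with (m * (31 * p))%nat by ring.
  apply Nat.mul_le_mono_l; lia. }
assert (nm : (n <= 15 * ((31 * m) * (31 * m)))%nat).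
{ apply Nat.le_trans with (1 := np); apply Nat.mul_le_mono_l.
  simpl (_ ^ _)%nat; rewrite Nat.mul_1_r; now apply Nat.mul_le_mono. }
assert (m0 : (0 < m)%nat) by lia.
assert (N : 0 < INR n) by (apply lt_0_INR; lia).
assert (M : 0 < INR m) by (apply lt_0_INR; lia).
assert (H : INR n <= 14415 * (INR m * INR m)).
{ apply le_INR in nm; rewrite !mult_INR in nm; simpl in nm; lra. }
assert (K : ln (INR n) <= ln 14415 + 2 * ln (INR m)).
{ apply Rle_trans with (ln (14415 * (INR m * INR m))); [now apply ln_le_mono|].
  rewrite !ln_mult by nra; lra. }
replace (/ (2 * (INR 19 / INR n))) with (INR n * / 38).
- rewrite !Rmult_assoc, (Rmult_comm (/ 152)), Rmult_assoc.
  apply Rmult_le_compat_l; lra.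
- simpl; field; lra.
Qed.

From mathcomp Require all_boot all_order all_algebra complex Rstruct ring lra zify.

Module Expander.
Import mathcomp.boot.all_boot mathcomp.order.all_order mathcomp.algebra.all_algebra.
Import mathcomp.algebra_tactics.ring mathcomp.algebra_tactics.lra mathcomp.zify.zify.
Import mathcomp.real_closed.complex.
Set Implicit Arguments. Unset Strict Implicit. Unset Printing Implicit Defensive.
Import Order.TTheory GRing.Theory Num.Theory.
Local Open Scope ring_scope.

(** * A Hardy inequality on the discrete torus *)

Section Torus.
Variable k : nat.
Local Notation p := k.+2.
Definition torus : finType := ('I_p * 'I_p)%type.

Definition shear1 (z : torus) : torus := (z.1 + z.2, z.2).
Definition shear1V (z : torus) : torus := (z.1 - z.2, z.2).
Definition shear2 (z : torus) : torus := (z.1, z.2 + z.1).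
Definition shear2V (z : torus) : torus := (z.1, z.2 - z.1).

Lemma shear1K : cancel shear1 shear1V.
Proof. by case=> a b; rewrite /shear1V /= addrK. Qed.
Lemma shear1VK : cancel shear1V shear1.
Proof. by case=> a b; rewrite /shear1 /= subrK. Qed.
Lemma shear2K : cancel shear2 shear2V.
Proof. by case=> a b; rewrite /shear2V /= addrK. Qed.
Lemma shear2VK : cancel shear2V shear2.
Proof. by case=> a b; rewrite /shear2 /= subrK. Qed.

(** Residues are read as integers around 0: positive, negative or zero, of absolute value below
    [p / 4]. Sums and differences of two of them stay below [p / 2], so on the box the shears act as
    on integer vectors. *)
Definition small_pos (a : nat) := (0 < a)%N && (4 * a < p)%N.
Definition small_neg (a : nat) := (a < p)%N && (3 * p < 4 * a)%N.
Definition small (a : nat) := [|| a == 0%N, small_pos a | small_neg a].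
Definition inbox (z : torus) := small z.1 && small z.2.

Definition same_sign (a b : nat) :=
  (small_pos a && small_pos b) || (small_neg a && small_neg b).
Definition opp_sign (a b : nat) :=
  (small_pos a && small_neg b) || (small_neg a && small_pos b).
Definition axis (a b : nat) := (a == 0%N) && (small_pos b || small_neg b).

(* Twice the flow along the edges from [z] to its images by the shears.  In the
   box these images are the children of [z] in the tree of the Euclidean
   algorithm; a point on an axis shares its children with the other axis, hence
   the weight 1/2. *)
Definition wS (z : torus) : nat := 2 * same_sign z.1 z.2 + axis z.1 z.2.
Definition wSV (z : torus) : nat := 2 * opp_sign z.1 z.2 + axis z.1 z.2.
Definition wT (z : torus) : nat := 2 * same_sign z.1 z.2 + axis z.2 z.1.
Definition wTV (z : torus) : nat := 2 * opp_sign z.1 z.2 + axis z.2 z.1.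

Lemma val_addI (a b : 'I_p) : (a + b)%R = (if a + b < p then a + b else a + b - p)%N :> nat.
Proof.
rewrite /=; case: ltnP => h; first by rewrite modn_small.
rewrite -{1}(subnK h) modnDr modn_small //.
have := ltn_ord a; have := ltn_ord b; lia.
Qed.

Lemma val_subI (a b : 'I_p) : (a - b)%R = (if b <= a then a - b else a + p - b)%N :> nat.
Proof.
have ha := ltn_ord a; have hb := ltn_ord b.
rewrite /= modnDmr; case: leqP => h.
  by rewrite addnBA ?(ltnW hb) // addnC -addnBA // modnDl modn_small //; lia.
by rewrite addnBA ?(ltnW hb) // modn_small //; lia.
Qed.

Variant position (v : nat) : bool -> bool -> bool -> Type :=
| PosZero of v = 0%N : position v true false false
| PosPos of (0 < v)%N & (4 * v < p)%N : position v false true false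
| PosNeg of (v < p)%N & (3 * p < 4 * v)%N : position v false false true
| PosFar of (p <= 4 * v)%N & (4 * v <= 3 * p)%N : position v false false false.

Lemma positionP (v : nat) : (v < p)%N ->
  position v (v == 0%N) (small_pos v) (small_neg v).
Proof.
rewrite /small_pos /small_neg => vp; case: (posnP v) => [-> | v0].
  by rewrite muln0; constructor.
have [h|h] := ltnP (4 * v) p; have [h'|h'] := ltnP (3 * p) (4 * v); rewrite ?vp /=.
- by exfalso; lia.
- by constructor.
- by constructor.
- by constructor.
Qed.

(** In the box, a point off the axes has two children and at most one parent, or two half parents if
    its coordinates agree up to sign; a point on an axis is a root with two half children. So each
    nonzero point of the box emits at least one unit more than it receives, and a point outside
    receives at most one. Units are doubled. *)
Lemma flow_balance (z : torus) : z != (0, 0) ->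
  (wS (shear1V z) + wSV (shear1 z) + wT (shear2V z) + wTV (shear2 z) + 2 * inbox z
   <= wS z + wSV z + wT z + wTV z + 2 * ~~ inbox z)%N.
Proof.
case: z => a b; rewrite xpair_eqE negb_and -!val_eqE /=.
 have ha := ltn_ord a;  have hb := ltn_ord b.
have e1 := val_addI a b; have e2 := val_addI b a.
have e3 := val_subI a b; have e4 := val_subI b a.
rewrite /wS /wSV /wT /wTV /shear1 /shear2 /shear1V /shear2V /inbox.
cbv beta iota delta [fst snd].
move: (a + b) (b + a) (a - b) (b - a) e1 e2 e3 e4 => s1 s2 d1 d2.
move: (nat_of_ord a) (nat_of_ord b) ha hb => x y ha hb -> -> -> -> nz.
rewrite /same_sign /opp_sign /axis /small.
have l1 : ((if x + y < p then x + y else x + y - p) < p)%N by case: ifP => ?; lia.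
have l2 : ((if y + x < p then y + x else y + x - p) < p)%N by case: ifP => ?; lia.
have l3 : ((if y <= x then x - y else x + p - y) < p)%N by case: ifP => ?; lia.
have l4 : ((if x <= y then y - x else y + p - x) < p)%N by case: ifP => ?; lia.
(* From here on only the congruences defining the sum and the differences matter: the position of
   each residue leaves a finite case analysis in linear arithmetic. *)
have e1 : (x + y = (if x + y < p then x + y else x + y - p) \/ x + y = (if x + y < p then x + y else x + y - p) + p)%N by case: ifP => ?; lia.
have e3 : (x = (if y <= x then x - y else x + p - y) + y \/ x + p = (if y <= x then x - y else x + p - y) + y)%N by case: ifP => ?; lia.
have e4 : (y = (if x <= y then y - x else y + p - x) + x \/ y + p = (if x <= y then y - x else y + p - x) + x)%N by case: ifP => ?; lia.
rewrite [in (y + x)%N]addnC in l2 *.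
move: nz l1 l2 l3 l4 e1 e3 e4.
move: (if (x + y < p)%N then _ else _) (if (y <= x)%N then _ else _) (if (x <= y)%N then _ else _) => s d d' nz l1 _ l3 l4 e1 e3 e4.
move: nz; case: (positionP ha) => h1; case: (positionP hb) => h2 //= *;
  case: (positionP l1) => //= *; try (exfalso; lia);
  case: (positionP l3) => //= *; try (exfalso; lia);
  case: (positionP l4) => //= *; exfalso; lia.
Qed.

Lemma out_flow_le (z : torus) :
  (wS z + wSV z + wT z + wTV z <= 4 * inbox z)%N.
Proof.
rewrite /wS /wSV /wT /wTV /inbox /same_sign /opp_sign /axis /small.
by case: (positionP (ltn_ord z.1)); case: (positionP (ltn_ord z.2)).
Qed.

Lemma in_flow_le (z : torus) : z != (0, 0) ->
  (wS (shear1V z) + wSV (shear1 z) + wT (shear2V z) + wTV (shear2 z) <= 2)%N.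
Proof.
by move=> /flow_balance; have := out_flow_le z; case: (inbox z) => /=; lia.
Qed.

(** Any factor below 2 in front of [y ^+ 2] would serve [torus_hardy]: the inflow there weighs at
    most twice the sum of squares, so the excess of the factor over 1 is absorbed by the balance.
    The constant 6 is [2 * 3], with 3 the price of the factor 3/2. *)
Lemma flow_step (R : realFieldType) (w : nat) (x y : R) : (w <= 2)%N ->
  w%:R * x ^+ 2 <= 3 / 2 * (w%:R * y ^+ 2) + 6 * (x - y) ^+ 2.
Proof.
move=> w2; have h : x ^+ 2 <= 3 / 2 * y ^+ 2 + 3 * (x - y) ^+ 2.
  have : 0 <= (3 * y - 2 * x) ^+ 2 by exact: sqr_ge0.
  nra.
have w0 : 0 <= w%:R :> R by rewrite ler0n.
have wl : w%:R <= 2%:R :> R by rewrite ler_nat.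
have d0 := sqr_ge0 (x - y).
nra.
Qed.

(** Along an edge of the flow, the square at the parent is bounded by the square at the child and
    the energy of the edge. Summed with the weights, this bounds the outflow by the inflow, whereas
    the balance makes the outflow exceed the inflow by the squares over the box. *)
Lemma torus_hardy (R : realFieldType) (g : torus -> R) : g (0, 0) = 0 ->
  \sum_z g z ^+ 2 <= 4 * (\sum_(z | ~~ inbox z) g z ^+ 2)
    + 12 * \sum_z ((g z - g (shear1 z)) ^+ 2 + (g z - g (shear2 z)) ^+ 2).
Proof.
move=> g0.
pose E1 := \sum_z (g z - g (shear1 z)) ^+ 2.
pose E2 := \sum_z (g z - g (shear2 z)) ^+ 2.
have E1V : \sum_z (g z - g (shear1V z)) ^+ 2 = E1.
  rewrite (reindex_inj (can_inj shear1K)); apply: eq_bigr => z _.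
  by rewrite shear1K -sqrrN opprB.
have E2V : \sum_z (g z - g (shear2V z)) ^+ 2 = E2.
  rewrite (reindex_inj (can_inj shear2K)); apply: eq_bigr => z _.
  by rewrite shear2K -sqrrN opprB.
have key (w : torus -> nat) (c cV : torus -> torus) : cancel c cV -> cancel cV c ->
    (forall z, w z <= 2)%N ->
    \sum_z (w z)%:R * g z ^+ 2 <= 3 / 2 * (\sum_z (w (cV z))%:R * g z ^+ 2)
      + 6 * \sum_z (g z - g (c z)) ^+ 2.
  move=> cK cVK w2; rewrite [X in 3 / 2 * X](reindex_inj (can_inj cK)) /=.
  rewrite !mulr_sumr -big_split /=; apply: ler_sum => z _.
  by rewrite cK; exact: flow_step.
have w2 z : [/\ wS z <= 2, wSV z <= 2, wT z <= 2 & wTV z <= 2]%N.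
  rewrite /wS /wSV /wT /wTV /same_sign /opp_sign /axis.
  by case: (positionP (ltn_ord z.1)); case: (positionP (ltn_ord z.2)).
have k1 := key wS _ _ shear1K shear1VK (fun z => ltac:(by case: (w2 z))).
have k2 := key wSV _ _ shear1VK shear1K (fun z => ltac:(by case: (w2 z))).
have k3 := key wT _ _ shear2K shear2VK (fun z => ltac:(by case: (w2 z))).
have k4 := key wTV _ _ shear2VK shear2K (fun z => ltac:(by case: (w2 z))).
rewrite {w2 key} E1V in k2; rewrite E2V in k4.
rewrite -/E1 in k1; rewrite -/E2 in k3.
have EE : \sum_z ((g z - g (shear1 z)) ^+ 2 + (g z - g (shear2 z)) ^+ 2) = E1 + E2.
  by rewrite big_split.
pose I := \sum_z (wS (shear1V z) + wSV (shear1 z) + wT (shear2V z) + wTV (shear2 z))%:R * g z ^+ 2.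
pose O := \sum_z (wS z + wSV z + wT z + wTV z)%:R * g z ^+ 2.
have IE : I = \sum_z (wS (shear1V z))%:R * g z ^+ 2 + \sum_z (wSV (shear1 z))%:R * g z ^+ 2
   + \sum_z (wT (shear2V z))%:R * g z ^+ 2 + \sum_z (wTV (shear2 z))%:R * g z ^+ 2.
  by rewrite -!big_split /=; apply: eq_bigr => z _; rewrite !natrD !mulrDl.
have OE : O = \sum_z (wS z)%:R * g z ^+ 2 + \sum_z (wSV z)%:R * g z ^+ 2
   + \sum_z (wT z)%:R * g z ^+ 2 + \sum_z (wTV z)%:R * g z ^+ 2.
  by rewrite -!big_split /=; apply: eq_bigr => z _; rewrite !natrD !mulrDl.
have I2 : I <= 2 * \sum_z g z ^+ 2.
  rewrite mulr_sumr; apply: ler_sum => z _.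
  have [-> | nz] := eqVneq z (0, 0); first by rewrite g0 expr0n !mulr0.
  by rewrite ler_wpM2r ?sqr_ge0 // ler_nat in_flow_le.
have bal : I + 2 * \sum_z g z ^+ 2 <= O + 4 * (\sum_(z | ~~ inbox z) g z ^+ 2).
  rewrite (big_mkcond (fun z => ~~ inbox z)) !mulr_sumr -!big_split /=.
  apply: ler_sum => z _.
  have [-> | nz] := eqVneq z (0, 0); first by rewrite g0 expr0n; case: (inbox _); rewrite /= !mulr0.
  have := flow_balance nz; have s0 := sqr_ge0 (g z).
  case: (inbox z); rewrite /= ?(muln0, muln1, addn0) -(ler_nat R) [(_ + 2)%:R]natrD => h; nra.
rewrite EE; lra.
Qed.
End Torus.

(** * Fourier analysis on the discrete torus *)

Section Fourier.
Variables (R : realFieldType) (k : nat).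
Local Notation p := k.+2.
Local Notation torus := (torus k).
Variables co si : 'I_p -> R.
Hypothesis co0 : co 0 = 1.
Hypothesis si0 : si 0 = 0.
Hypothesis coD : forall x y, co (x + y) = co x * co y - si x * si y.
Hypothesis siD : forall x y, si (x + y) = si x * co y + co x * si y.
Hypothesis coN : forall x, co (- x) = co x.
Hypothesis siN : forall x, si (- x) = - si x.
Hypothesis co_neq1 : forall x, x != 0 -> co x != 1.
Hypothesis co_far : forall x : 'I_p, (p <= 4 * x)%N -> (4 * x <= 3 * p)%N -> co x <= 0.

Lemma co2Dsi2 x : co x ^+ 2 + si x ^+ 2 = 1.
Proof. by have := coD x (- x); rewrite subrr co0 coN siN => ->; ring. Qed.

(** Translating [a] by 1 shows that the pair of sums is fixed by the rotation [(co v, si v)]; its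
    difference from the identity has determinant [2 * (1 - co v)], which is not 0. *)
Lemma char_sum (v : 'I_p) : v != 0 ->
  \sum_(a : 'I_p) co (v * a) = 0 /\ \sum_(a : 'I_p) si (v * a) = 0.
Proof.
move=> v0; set X := \sum_a co _; set Y := \sum_a si _.
have EX : X = co v * X - si v * Y.
  rewrite {1}/X (reindex_inj (addrI (1 : 'I_p))) /= !mulr_sumr -sumrB.
  by apply: eq_bigr => a _; rewrite mulrDr mulr1 coD.
have EY : Y = si v * X + co v * Y.
  rewrite {1}/Y (reindex_inj (addrI (1 : 'I_p))) /= !mulr_sumr -big_split.
  by apply: eq_bigr => a _; rewrite mulrDr mulr1 siD.
have c2 := co2Dsi2 v.
have h : 2 * (1 - co v) != 0 by rewrite mulf_neq0 ?pnatr_eq0 // subr_eq0 eq_sym co_neq1.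
split; apply: (mulfI h); rewrite mulr0.
- have -> : 2 * (1 - co v) = (1 - co v) ^+ 2 + si v ^+ 2 by rewrite -[si v ^+ 2](addKr (co v ^+ 2)) c2; ring.
  have -> : ((1 - co v) ^+ 2 + si v ^+ 2) * X = (1 - co v) * (X - (co v * X - si v * Y)) - si v * (Y - (si v * X + co v * Y)) by ring.
  by rewrite -EX -EY !subrr !mulr0 subrr.
- have -> : 2 * (1 - co v) = (1 - co v) ^+ 2 + si v ^+ 2 by rewrite -[si v ^+ 2](addKr (co v ^+ 2)) c2; ring.
  have -> : ((1 - co v) ^+ 2 + si v ^+ 2) * Y = si v * (X - (co v * X - si v * Y)) + (1 - co v) * (Y - (si v * X + co v * Y)) by ring.
  by rewrite -EX -EY !subrr !mulr0 addr0.
Qed.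

Definition pairing (z w : torus) : 'I_p := z.1 * w.1 + z.2 * w.2.

Lemma sum_torus (F : torus -> R) : \sum_z F z = \sum_a \sum_b F (a, b).
Proof. by rewrite pair_bigA; apply: eq_bigr => -[]. Qed.

Lemma orthogonality (v : torus) :
  \sum_w co (pairing v w) = if v == (0, 0) then (p ^ 2)%:R else 0.
Proof.
have -> : \sum_w co (pairing v w) =
    (\sum_a co (v.1 * a)) * (\sum_b co (v.2 * b))
    - (\sum_a si (v.1 * a)) * (\sum_b si (v.2 * b)).
  rewrite sum_torus !mulr_suml -sumrB; apply: eq_bigr => a _.
  by rewrite !mulr_sumr -sumrB; apply: eq_bigr => b _; rewrite coD.
case: v => v1 v2 /=; rewrite xpair_eqE.
have [->|n1] := eqVneq v1 0; last first.
  by have [-> ->] := char_sum n1; rewrite !mul0r subr0.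
have [->|n2] := eqVneq v2 0; last first.
  by have [-> ->] := char_sum n2; rewrite !mulr0 subr0.
have -> : \sum_(a : 'I_p) co (0 * a) = p%:R.
  rewrite (eq_bigr (fun=> 1)) => [|a _]; last by rewrite mul0r co0.
  by rewrite sumr_const card_ord.
have -> : \sum_(a : 'I_p) si (0 * a) = 0.
  by rewrite big1 // => a _; rewrite mul0r si0.
by rewrite mulr0 subr0 /= -natrM.
Qed.

(** Real and imaginary parts of the Fourier transform, kept apart so that the real Hardy inequality
    applies to each of them. *)
Definition FC (f : torus -> R) (w : torus) := \sum_z f z * co (pairing z w).
Definition FS (f : torus -> R) (w : torus) := \sum_z f z * si (pairing z w).

Lemma pairingB (z z' w : torus) :
  pairing (z.1 - z'.1, z.2 - z'.2) w = pairing z w - pairing z' w.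
Proof. by rewrite /pairing /=; ring. Qed.

Lemma parseval (f : torus -> R) :
  \sum_w (FC f w ^+ 2 + FS f w ^+ 2) = (p ^ 2)%:R * \sum_z f z ^+ 2.
Proof.
transitivity (\sum_w \sum_z \sum_z' f z * f z' * co (pairing z w - pairing z' w)).
  apply: eq_bigr => w _; rewrite !expr2 !big_distrl /= -big_split /=.
  apply: eq_bigr => z _; rewrite !mulr_sumr -big_split /=.
  by apply: eq_bigr => z' _; rewrite coD coN siN; ring.
rewrite exchange_big mulr_sumr /=; apply: eq_bigr => z _.
rewrite exchange_big /= (bigD1 z) //= [X in _ + X]big1 => [|z' nz].
  rewrite addr0 -mulr_sumr.
  rewrite (eq_bigr (fun w => co (pairing (0, 0) w))) => [|w _].
    by rewrite orthogonality eqxx; ring.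
  by rewrite subrr /pairing /= !mul0r addr0.
rewrite -mulr_sumr (eq_bigr (fun w => co (pairing (z.1 - z'.1, z.2 - z'.2) w))) => [|w _].
  rewrite orthogonality ifN ?mulr0 //; apply: contra nz.
  by case: z z' => [a b] [a' b']; rewrite !xpair_eqE /= !subr_eq0 ![a' == _]eq_sym ![b' == _]eq_sym.
by rewrite pairingB.
Qed.

Definition shift1 (z : torus) : torus := (z.1 + 1, z.2).
Definition shift2 (z : torus) : torus := (z.1, z.2 + 1).
Lemma shift1_inj : injective shift1.
Proof. by apply: (can_inj (g := fun z => (z.1 - 1, z.2))) => -[a b]; rewrite /= addrK. Qed.
Lemma shift2_inj : injective shift2.
Proof. by apply: (can_inj (g := fun z => (z.1, z.2 - 1))) => -[a b]; rewrite /= addrK. Qed.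

Lemma transform_comp (h : 'I_p -> R) (f : torus -> R) (c d : torus -> torus) w :
  injective c -> (forall z, pairing (c z) (d w) = pairing z w) ->
  \sum_z f (c z) * h (pairing z w) = \sum_z f z * h (pairing z (d w)).
Proof.
by move=> ci cd; rewrite [RHS](reindex_inj ci); apply: eq_bigr => z _; rewrite cd.
Qed.

Lemma transform_sub (h : 'I_p -> R) (f g : torus -> R) w :
  \sum_z (f z - g z) * h (pairing z w) =
  \sum_z f z * h (pairing z w) - \sum_z g z * h (pairing z w).
Proof. by rewrite -sumrB; apply: eq_bigr => z _; rewrite mulrBl. Qed.

Lemma pairing_shear1 z w : pairing (shear1 z) (shear2V w) = pairing z w.
Proof. by rewrite /pairing /=; ring. Qed.
Lemma pairing_shear2 z w : pairing (shear2 z) (shear1V w) = pairing z w.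
Proof. by rewrite /pairing /=; ring. Qed.

(** The transform turns a shear into its inverse transpose, again a shear: the shear energy of [f]
    reappears as a shear energy on the frequency side. *)
Lemma shear_energy (f : torus -> R) (c d dV : torus -> torus) :
  injective c -> cancel d dV -> (forall z w, pairing (c z) (dV w) = pairing z w) ->
  \sum_w (FC f w - FC f (d w)) ^+ 2 + \sum_w (FS f w - FS f (d w)) ^+ 2 =
  (p ^ 2)%:R * \sum_z (f z - f (c z)) ^+ 2.
Proof.
move=> ci dK cd; rewrite -parseval -big_split /= [RHS](reindex_inj (can_inj dK)).
apply: eq_bigr => w _; rewrite /FC /FS !transform_sub.
rewrite !(transform_comp _ _ ci (fun z => cd z (d w))) dK.
by rewrite -[in RHS]sqrrN opprB -[X in _ = _ + X]sqrrN opprB.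
Qed.

(** A translation multiplies the transform by a character [e^{iu}], and
    [|1 - e^{iu}|^2 = 2 - 2 cos u]. *)
Lemma shift_energy (f : torus -> R) (c : torus -> torus) (u : torus -> 'I_p) :
  injective c -> (forall z w, pairing (c z) w = pairing z w + u w) ->
  \sum_w (2 - 2 * co (u w)) * (FC f w ^+ 2 + FS f w ^+ 2) =
  (p ^ 2)%:R * \sum_z (f z - f (c z)) ^+ 2.
Proof.
move=> ci cu; rewrite -parseval; apply: eq_bigr => w _.
have E1 : \sum_z f (c z) * co (pairing z w) = co (u w) * FC f w + si (u w) * FS f w.
  rewrite /FC /FS !mulr_sumr -big_split /= [RHS](reindex_inj ci) /=.
  apply: eq_bigr => z _; rewrite cu coD siD.
  by have := co2Dsi2 (u w) => h; rewrite -[in LHS](mulr1 (co (pairing z w))) -h; ring.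
have E2 : \sum_z f (c z) * si (pairing z w) = co (u w) * FS f w - si (u w) * FC f w.
  rewrite /FC /FS !mulr_sumr -sumrB /= [RHS](reindex_inj ci) /=.
  apply: eq_bigr => z _; rewrite cu coD siD.
  by have := co2Dsi2 (u w) => h; rewrite -[in LHS](mulr1 (si (pairing z w))) -h; ring.
rewrite [in RHS]/FC [in RHS]/FS !transform_sub E1 E2 -/(FC f w) -/(FS f w).
have h := co2Dsi2 (u w).
have -> : 2 - 2 * co (u w) = 1 + (co (u w) ^+ 2 + si (u w) ^+ 2) - 2 * co (u w) by rewrite h.
ring.
Qed.

(** Sum 0 means that the transform vanishes at the origin, as the Hardy inequality requires. At a
    frequency outside the box some coordinate has [co <= 0], so its translation factor [2 - 2 co] is
    at least 2 and the translations pay for the boundary term. *)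
Lemma torus_poincare_char (f : torus -> R) : \sum_z f z = 0 ->
  \sum_z f z ^+ 2 <= 12 * \sum_z ((f z - f (shear1 z)) ^+ 2 + (f z - f (shear2 z)) ^+ 2
     + (f z - f (shift1 z)) ^+ 2 + (f z - f (shift2 z)) ^+ 2).
Proof.
move=> f0.
have pair0 z : pairing z (0, 0) = 0 by rewrite /pairing !mulr0 addr0.
have FC0 : FC f (0, 0) = 0.
  by rewrite /FC -[RHS]f0; apply: eq_bigr => z _; rewrite pair0 co0 mulr1.
have FS0 : FS f (0, 0) = 0.
  by rewrite /FS big1 // => z _; rewrite pair0 si0 mulr0.
have hC := torus_hardy FC0; have hS := torus_hardy FS0.
have S1 := shear_energy f (can_inj (@shear1K k)) (@shear2K k) pairing_shear1.
have S2 := shear_energy f (can_inj (@shear2K k)) (@shear1K k) pairing_shear2.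
have P := parseval f.
have T1 : \sum_w (2 - 2 * co w.1) * (FC f w ^+ 2 + FS f w ^+ 2) = _ :=
  shift_energy f shift1_inj
  (fun z w => ltac:(by rewrite /pairing /=; ring) : pairing (shift1 z) w = pairing z w + w.1).
have T2 : \sum_w (2 - 2 * co w.2) * (FC f w ^+ 2 + FS f w ^+ 2) = _ :=
  shift_energy f shift2_inj
  (fun z w => ltac:(by rewrite /pairing /=; ring) : pairing (shift2 z) w = pairing z w + w.2).
have co1 x : co x <= 1.
  have := co2Dsi2 x; have := sqr_ge0 (si x); nra.
have far (x : 'I_p) : ~~ small k x -> co x <= 0.
  rewrite /small; case: (positionP (ltn_ord x)) => //= h1 h2 _; exact: co_far.
have B : 2 * (\sum_(w | ~~ inbox w) FC f w ^+ 2 + \sum_(w | ~~ inbox w) FS f w ^+ 2) <=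
    \sum_w (2 - 2 * co w.1) * (FC f w ^+ 2 + FS f w ^+ 2) +
    \sum_w (2 - 2 * co w.2) * (FC f w ^+ 2 + FS f w ^+ 2).
  rewrite -!big_split /= big_mkcond mulr_sumr /=; apply: ler_sum => w _.
  have s1 := sqr_ge0 (FC f w); have s2 := sqr_ge0 (FS f w).
  have c1 := co1 w.1; have c2 := co1 w.2.
  case: ifP => [|_]; last by nra.
  rewrite negb_and => /orP [/far|/far] h; nra.
move: hC hS; rewrite !big_split /= => hC hS.
rewrite !big_split /= in P.
have p0 : 0 < (p ^ 2)%:R :> R by rewrite ltr0n expn_gt0.
rewrite -(ler_pM2l p0) mulrCA !mulrDr -S1 -S2 -T1 -T2 -P.
set U1 := \sum_w (2 - 2 * co w.1) * _ in B *.
set U2 := \sum_w (2 - 2 * co w.2) * _ in B *.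
have U10 : 0 <= U1.
  apply: sumr_ge0 => w _; apply: mulr_ge0; last by rewrite addr_ge0 ?sqr_ge0.
  by have := co1 w.1; lra.
have U20 : 0 <= U2.
  apply: sumr_ge0 => w _; apply: mulr_ge0; last by rewrite addr_ge0 ?sqr_ge0.
  by have := co1 w.2; lra.
lra.
Qed.
End Fourier.

(** * The graph *)

(* Adjacency lists of the two cells, on 14 and 15 vertices, found by computer
   search.  Vertices 0 to 7 are ports and have degree 5: for q < 4, port q of a
   cell is joined to port q + 4 of its image by the q-th generator.  Vertices
   8, 9, 10 form the triangle that the rule keeps for last. *)
Definition gadget (b : bool) : seq (seq nat) :=
  if b then
  [:: [:: 1; 2; 11; 13; 14]; [:: 0; 2; 7; 13; 14]; [:: 0; 1; 3; 12; 14];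
      [:: 2; 4; 11; 12; 13]; [:: 3; 5; 6; 7; 11]; [:: 4; 6; 8; 9; 14];
      [:: 4; 5; 7; 9; 10]; [:: 1; 4; 6; 8; 10]; [:: 5; 7; 9; 10; 12; 14];
      [:: 5; 6; 8; 10; 11; 12]; [:: 6; 7; 8; 9; 11; 13]; [:: 0; 3; 4; 9; 10; 12];
      [:: 2; 3; 8; 9; 11; 13]; [:: 0; 1; 3; 10; 12; 14]; [:: 0; 1; 2; 5; 8; 13]]%N
  else
  [:: [:: 1; 3; 5; 6; 9]; [:: 0; 2; 4; 11; 12]; [:: 1; 3; 4; 8; 12];
      [:: 0; 2; 4; 8; 9]; [:: 1; 2; 3; 5; 11]; [:: 0; 4; 6; 11; 13];
      [:: 0; 5; 7; 10; 13]; [:: 6; 8; 10; 11; 13]; [:: 2; 3; 7; 9; 10; 12];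
      [:: 0; 3; 8; 10; 12; 13]; [:: 6; 7; 8; 9; 11; 13]; [:: 1; 4; 5; 7; 10; 12];
      [:: 1; 2; 8; 9; 11; 13]; [:: 5; 6; 7; 9; 10; 12]]%N.

(* The i-th entry is an induced path from port 6 to port 2 through vertex i which
   contains no further port, except possibly i. *)
Definition gpaths (b : bool) : seq (seq nat) :=
  if b then
  [:: [:: 6; 9; 11; 0; 2]; [:: 6; 10; 13; 1; 2]; [:: 6; 9; 8; 14; 2];
      [:: 6; 9; 11; 3; 2]; [:: 6; 4; 11; 12; 2]; [:: 6; 5; 8; 12; 2];
      [:: 6; 9; 8; 14; 2]; [:: 6; 7; 8; 12; 2]; [:: 6; 9; 8; 14; 2];
      [:: 6; 9; 8; 14; 2]; [:: 6; 10; 8; 12; 2]; [:: 6; 10; 11; 12; 2];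
      [:: 6; 10; 8; 12; 2]; [:: 6; 10; 13; 12; 2]; [:: 6; 9; 8; 14; 2]]%N
  else
  [:: [:: 6; 0; 9; 8; 2]; [:: 6; 10; 11; 1; 2]; [:: 6; 10; 9; 12; 2];
      [:: 6; 10; 9; 3; 2]; [:: 6; 10; 11; 4; 2]; [:: 6; 5; 11; 12; 2];
      [:: 6; 10; 9; 12; 2]; [:: 6; 7; 11; 12; 2]; [:: 6; 13; 9; 8; 2];
      [:: 6; 10; 9; 12; 2]; [:: 6; 10; 9; 12; 2]; [:: 6; 10; 11; 12; 2];
      [:: 6; 10; 9; 12; 2]; [:: 6; 13; 9; 8; 2]]%N.

Definition gadj (b : bool) (i j : nat) : bool := j \in nth [::] (gadget b) i.
(** Written as a visible successor, so that [inord] can name the vertices of a cell by natural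
    numbers. *)
Definition gsize (b : bool) : nat := (13 + b).+1.
Definition gtri (i j : nat) : bool :=
  [&& i != j, i \in [:: 8; 9; 10]%N & j \in [:: 8; 9; 10]%N].
Definition gpath (b : bool) (v t : nat) : nat := nth 0%N (nth [::] (gpaths b) v) t.
Definition opp_port (i : nat) : nat := ((i + 4) %% 8)%N.

Lemma gsize_iota b i : (i < gsize b)%N -> i \in iota 0 (gsize b).
Proof. by rewrite mem_iota. Qed.

Lemma gadget_check (P : bool -> nat -> bool) :
  (forall b, all (P b) (iota 0 (gsize b))) ->
  forall b i, (i < gsize b)%N -> P b i.
Proof. by move=> H b i /gsize_iota ib; exact: (allP (H b)). Qed.

Lemma gadget_check2 (P : bool -> nat -> nat -> bool) :
  (forall b, all (fun i => all (P b i) (iota 0 (gsize b))) (iota 0 (gsize b))) ->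
  forall b i j, (i < gsize b)%N -> (j < gsize b)%N -> P b i j.
Proof. by move=> H b i j /gsize_iota ib /gsize_iota; apply/allP; exact: (allP (H b) i ib). Qed.

Lemma gadj_sym b i j : (i < gsize b)%N -> (j < gsize b)%N -> gadj b i j = gadj b j i.
Proof.
move=> ib jb; apply/eqP; move: b i j ib jb.
by apply: (@gadget_check2 (fun b i j => gadj b i j == gadj b j i)); case; vm_compute.
Qed.

Lemma gadj_irrefl b i : (i < gsize b)%N -> gadj b i i = false.
Proof.
move=> ib; apply/negbTE; move: b i ib.
by apply: (@gadget_check (fun b i => ~~ gadj b i i)); case; vm_compute.
Qed.

(** A shear fixes the cells on an axis and then joins two opposite ports of one cell; this keeps
    such an edge from doubling an internal one. *)
Lemma gadj_opp b i : (i < gsize b)%N -> (i < 8)%N -> gadj b i (opp_port i) = false.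
Proof.
move=> ib i8; apply/negbTE; apply: (implyP _ i8); move: b i {i8} ib.
by apply: (@gadget_check (fun b i => (i < 8)%N ==> ~~ gadj b i (opp_port i))); case; vm_compute.
Qed.

Lemma gadj_degree b i : (i < gsize b)%N ->
  (count (gadj b i) (iota 0 (gsize b)) + (i < 8) = 6)%N.
Proof.
move=> ib; apply/eqP; move: b i ib.
by apply: (@gadget_check (fun b i => (count (gadj b i) (iota 0 (gsize b)) + (i < 8)%N == 6)%N)); case; vm_compute.
Qed.

(** The numbering is a Hamiltonian path of each cell, along which [cell_variation] telescopes. *)
Lemma gadj_succ b i : (i.+1 < gsize b)%N -> gadj b i i.+1.
Proof.
move=> ib; apply: (implyP _ ib); have {}ib := ltnW ib; move: b i ib.
by apply: (@gadget_check (fun b i => (i.+1 < gsize b)%N ==> gadj b i i.+1)); case; vm_compute.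
Qed.

Lemma gadj_triangle b i : (i < gsize b)%N -> exists j l : nat,
  [/\ (j < gsize b)%N, (l < gsize b)%N, gadj b i j, gadj b i l & gadj b j l].
Proof.
move=> ib; suff /hasP[j jb /hasP[l lb /and3P[h1 h2 h3]]] :
    has (fun j => has (fun l => [&& gadj b i j, gadj b i l & gadj b j l])
      (iota 0 (gsize b))) (iota 0 (gsize b)).
  by exists j, l; split => //; [move: jb | move: lb]; rewrite mem_iota.
move: b i ib.
by apply: (@gadget_check (fun b i => has (fun j => has (fun l =>
  [&& gadj b i j, gadj b i l & gadj b j l]) (iota 0 (gsize b))) (iota 0 (gsize b)))); case; vm_compute.
Qed.

Lemma gtri_gadj b i j : gtri i j -> gadj b i j.
Proof.
case/and3P; rewrite !inE => ij /or3P[]/eqP i8 /or3P[]/eqP j8; move: ij.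
all: by rewrite i8 j8; case: b.
Qed.

Lemma gtri_even b i : (i < gsize b)%N -> odd (count (gtri i) (iota 0 (gsize b))) = false.
Proof.
move=> ib; apply/negbTE; move: b i ib.
by apply: (@gadget_check (fun b i => ~~ odd (count (gtri i) (iota 0 (gsize b))))); case; vm_compute.
Qed.

Section Graph.
Variable k : nat.
Local Notation p := k.+2.
Local Notation torus := (torus k).
Variable B : {set torus}.

Definition shift1V (z : torus) : torus := (z.1 - 1, z.2).
Definition shift2V (z : torus) : torus := (z.1, z.2 - 1).
Lemma shift1K : cancel (@shift1 k) shift1V.
Proof. by case=> a b; rewrite /shift1V /= addrK. Qed.
Lemma shift1VK : cancel shift1V (@shift1 k).
Proof. by case=> a b; rewrite /shift1 /= subrK. Qed.
Lemma shift2K : cancel (@shift2 k) shift2V.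
Proof. by case=> a b; rewrite /shift2V /= addrK. Qed.
Lemma shift2VK : cancel shift2V (@shift2 k).
Proof. by case=> a b; rewrite /shift2 /= subrK. Qed.

Definition port_move (i : nat) : torus -> torus :=
  match i with
  | 0 => @shear1 k | 1 => @shear2 k | 2 => @shift1 k | 3 => @shift2 k
  | 4 => @shear1V k | 5 => @shear2V k | 6 => shift1V | _ => shift2V
  end.

Lemma port_moveK i : (i < 8)%N -> cancel (port_move i) (port_move (opp_port i)).
Proof.
by do 8?[case: i => [_|i]; first by [exact: shear1K | exact: shear2K | exact: shift1K
  | exact: shift2K | exact: shear1VK | exact: shear2VK | exact: shift1VK | exact: shift2VK]].
Qed.

Lemma opp_portK i : (i < 8)%N -> opp_port (opp_port i) = i.
Proof. by do 8?[case: i => [//|i]]. Qed.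
Lemma opp_port_lt i : (opp_port i < 8)%N.
Proof. exact: ltn_mod. Qed.
Lemma opp_port_neq i : (i < 8)%N -> opp_port i != i.
Proof. by do 8?[case: i => [//|i]]. Qed.

Definition csize (x : torus) : nat := gsize (x \in B).
Definition vertex : finType := {x : torus & 'I_(csize x)}.
Definition vtx (x : torus) (i : nat) : vertex := Tagged (fun x => 'I_(csize x)) (inord i : 'I_(csize x)).
Definition idx (v : vertex) : nat := tagged v.

Lemma idx_lt v : (idx v < csize (tag v))%N. Proof. exact: ltn_ord. Qed.
Lemma tag_vtx x i : tag (vtx x i) = x. Proof. by []. Qed.
Lemma idx_vtx x i : (i < csize x)%N -> idx (vtx x i) = i.
Proof. by move=> ix; rewrite /idx /= inordK. Qed.
Lemma vtxE v : vtx (tag v) (idx v) = v.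
Proof. by case: v => x i; rewrite /vtx /idx /= inord_val. Qed.
Lemma port_lt_csize i x : (i < 8)%N -> (i < csize x)%N.
Proof. by move=> i8; rewrite (leq_trans i8) // /csize /gsize; case: (x \in B). Qed.

Lemma csize_le x : (csize x <= 15)%N.
Proof. by rewrite /csize /gsize; case: (x \in B). Qed.

Definition adjv (v w : vertex) : bool :=
  (tag v == tag w) && gadj (tag v \in B) (idx v) (idx w)
  || [&& (idx v < 8)%N, tag w == port_move (idx v) (tag v) & idx w == opp_port (idx v)].
Definition triv (v w : vertex) : bool := (tag v == tag w) && gtri (idx v) (idx w).

Lemma adjv_sym v w : adjv v w = adjv w v.
Proof.
have half u u' : adjv u u' -> adjv u' u; last by apply/idP/idP; exact: half.
case/orP => [/andP[/eqP e h] | /and3P[h1 /eqP h2 /eqP h3]]; apply/orP; [left|right].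
  by rewrite -e eqxx /= gadj_sym //; [rewrite e|]; exact: idx_lt.
by rewrite h3 opp_port_lt h2 port_moveK // opp_portK // !eqxx.
Qed.

Lemma adjv_irrefl v : adjv v v = false.
Proof.
rewrite /adjv gadj_irrefl ?andbF /=; last exact: idx_lt.
by apply/negP => /and3P[h _ /eqP e]; have := opp_port_neq h; rewrite -e eqxx.
Qed.

Lemma triv_sym v w : triv v w = triv w v.
Proof. by rewrite /triv /gtri [tag w == _]eq_sym [idx w == _]eq_sym [(idx v \in _) && _]andbC. Qed.

Lemma triv_adjv v w : triv v w -> adjv v w.
Proof. by case/andP => h1 h2; rewrite /adjv h1 gtri_gadj. Qed.

Lemma sum_vertex (M : nmodType) (F : vertex -> M) :
  \sum_v F v = \sum_x \sum_(i < csize x) F (vtx x i).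
Proof.
rewrite (eq_bigr (fun v : vertex => F (Tagged (fun x => 'I_(csize x)) (tagged v)))); last by case.
rewrite -(sig_big_dep (fun=> true) (fun _ _ => true) (fun x i => F (Tagged (fun x => 'I_(csize x)) i))) /=.
by apply: eq_bigr => x _; apply: eq_bigr => i _; rewrite /vtx inord_val.
Qed.

Lemma sum_cell (M : nmodType) (P : pred vertex) (F : vertex -> M) (x : torus) :
  \sum_(w | (x == tag w) && P w) F w = \sum_(i < csize x | P (vtx x i)) F (vtx x i).
Proof.
rewrite big_mkcond sum_vertex (bigD1 x) //= [X in _ + X]big1 ?addr0 => [|y /negbTE yx].
  by rewrite [RHS]big_mkcond; apply: eq_bigr => i _; rewrite eqxx.
by rewrite big1 // => i _; rewrite eq_sym yx.
Qed.

Lemma sum_adjv (M : nmodType) (F : vertex -> M) (v : vertex) :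
  \sum_(w | adjv v w) F w =
  \sum_(j < csize (tag v) | gadj (tag v \in B) (idx v) j) F (vtx (tag v) j)
  + (if (idx v < 8)%N then F (vtx (port_move (idx v) (tag v)) (opp_port (idx v))) else 0).
Proof.
pose Q w := (tag v == tag w) && gadj (tag v \in B) (idx v) (idx w).
rewrite (bigID Q) /=; congr (_ + _).
  rewrite (eq_bigl Q) => [|w]; last first.
    by rewrite andbC; apply: andb_idr => q; rewrite /adjv -/(Q w) q.
  rewrite /Q (sum_cell (fun w => gadj (tag v \in B) (idx v) (idx w))).
  by apply: eq_bigl => j; rewrite idx_vtx.
case: ifP => v8; last first.
  by apply: big1 => w /andP[]; rewrite /adjv v8 orbF /Q => ->.
rewrite (big_pred1 (vtx (port_move (idx v) (tag v)) (opp_port (idx v)))) // => w.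
have ol := port_lt_csize (port_move (idx v) (tag v)) (opp_port_lt (idx v)).
rewrite /adjv /Q; apply/andP/eqP => [[/orP[->//|/and3P[_ /eqP h1 /eqP h2]] _] | ->].
  by rewrite -h1 -h2 vtxE.
rewrite tag_vtx idx_vtx // v8 !eqxx orbT; split => //.
by rewrite gadj_opp ?andbF //; exact: idx_lt.
Qed.

Lemma count_iota_ord (P : pred nat) (m : nat) : count P (iota 0 m) = (\sum_(j < m | P j) 1)%N.
Proof. by rewrite -sum1_count -[m in iota 0 m]subn0 big_mkord. Qed.

Lemma adjv_degree v : (\sum_(w | adjv v w) 1 = 6)%N.
Proof.
have -> : (\sum_(w | adjv v w) 1 = \sum_(j < csize (tag v) | gadj (tag v \in B) (idx v) j) 1
    + (if idx v < 8 then 1 else 0))%N := sum_adjv (fun=> 1%N) v.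
by rewrite -[RHS](gadj_degree (idx_lt v)) count_iota_ord; case: ifP.
Qed.

Lemma triv_even v : odd (\sum_(w | triv v w) 1)%N = false.
Proof.
have -> : (\sum_(w | triv v w) 1 =
    \sum_(j < csize (tag v) | gtri (idx v) (idx (vtx (tag v) j))) 1)%N.
  exact: (sum_cell (fun w => gtri (idx v) (idx w)) (fun=> 1%N) (tag v)).
rewrite -[RHS](gtri_even (idx_lt v)) count_iota_ord; congr odd.
by apply: eq_bigl => j; rewrite idx_vtx.
Qed.
End Graph.

(** * Poincaré inequalities on the graph *)

Section Energy.
Variables (R : realFieldType) (k : nat) (B : {set torus k}).
Local Notation torus := (torus k).
Local Notation vertex := (vertex B).
Local Notation vtx := (vtx B).
Local Notation csize := (csize B).

Section Form.
Variable q : vertex -> vertex -> R.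
Hypothesis q_ge0 : forall v w, 0 <= q v w.

Definition energy := \sum_v \sum_(w | adjv v w) q v w.
Definition cell_energy (x : torus) :=
  \sum_(i < csize x) \sum_(j < csize x | gadj (x \in B) i j) q (vtx x i) (vtx x j).

Lemma cell_energy_ge0 x : 0 <= cell_energy x.
Proof. by apply: sumr_ge0 => i _; apply: sumr_ge0. Qed.

Lemma energyE : energy = \sum_x cell_energy x + \sum_x \sum_(i < csize x)
  (if (i < 8)%N then q (vtx x i) (vtx (port_move i x) (opp_port i)) else 0).
Proof.
rewrite /energy sum_vertex -big_split; apply: eq_bigr => x _ /=.
rewrite -big_split; apply: eq_bigr => i _ /=.
by rewrite sum_adjv tag_vtx idx_vtx.
Qed.

Lemma cells_le_energy : \sum_x cell_energy x <= energy.
Proof.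
rewrite energyE lerDl; apply: sumr_ge0 => x _; apply: sumr_ge0 => i _.
by case: ifP.
Qed.

Lemma port_le_energy (i : nat) : (i < 8)%N ->
  \sum_x q (vtx x i) (vtx (port_move i x) (opp_port i)) <= energy.
Proof.
move=> i8; rewrite energyE -[leLHS]add0r; apply: lerD.
  by apply: sumr_ge0 => x _; exact: cell_energy_ge0.
apply: ler_sum => x _; rewrite (bigD1 (Ordinal (port_lt_csize B x i8))) //= i8 lerDl.
by apply: sumr_ge0 => j _; case: ifP.
Qed.

Lemma term_le_cell x i j : (i < csize x)%N -> (j < csize x)%N ->
  gadj (x \in B) i j -> q (vtx x i) (vtx x j) <= cell_energy x.
Proof.
move=> ix jx ij; rewrite /cell_energy (bigD1 (Ordinal ix)) //= (bigD1 (Ordinal jx)) //=.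
rewrite -addrA lerDl addr_ge0 //; first exact: sumr_ge0.
by apply: sumr_ge0 => l _; exact: sumr_ge0.
Qed.
End Form.

Definition diff_form (f : vertex -> R) v w := (f v - f w) ^+ 2.
Definition sum_form (f : vertex -> R) v w := (f v + f w) ^+ 2.

(** Crude telescoping with [(s + t)^2 <= 2 s^2 + 2 t^2]. Since cells have at most 15 vertices, any
    such constant is uniform in [p]. *)
Lemma cell_variation (f : vertex -> R) x i : (i < csize x)%N ->
  (f (vtx x i) - f (vtx x 0)) ^+ 2 <= 4 ^+ i * cell_energy (diff_form f) x.
Proof.
have e0 : 0 <= cell_energy (diff_form f) x.
  by apply: cell_energy_ge0 => v w; exact: sqr_ge0.
elim: i => [_|i IH ix]; first by rewrite subrr expr0n mul1r.
have h := IH (ltnW ix).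
have h1 : (f (vtx x i) - f (vtx x i.+1)) ^+ 2 <= cell_energy (diff_form f) x.
  apply: (term_le_cell (q := diff_form f)) => //; first by move=> v w; exact: sqr_ge0.
    exact: ltnW.
  exact: gadj_succ.
have c1 : 1 <= 4 ^+ i :> R by rewrite exprn_ege1 // ler1n.
have h2 := sqr_ge0 (f (vtx x i) - f (vtx x 0) + (f (vtx x i) - f (vtx x i.+1))).
have h3 : cell_energy (diff_form f) x <= 4 ^+ i * cell_energy (diff_form f) x.
  by rewrite ler_peMl.
rewrite [4 ^+ _]exprS -mulrA; nra.
Qed.

Lemma cell_variation15 (f : vertex -> R) x i : (i < csize x)%N ->
  (f (vtx x i) - f (vtx x 0)) ^+ 2 <= 4 ^+ 15 * cell_energy (diff_form f) x.
Proof.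
move=> ix; apply: le_trans (cell_variation f ix) _.
rewrite ler_wpM2r //; first by apply: cell_energy_ge0 => v w; exact: sqr_ge0.
by rewrite ler_weXn2l // ?ler1n // ltnW // (leq_trans ix) // csize_le.
Qed.

Lemma port_moved_cells (F : torus -> R) i : (i < 8)%N ->
  \sum_x F (port_move i x) = \sum_x F x.
Proof. by move=> i8; rewrite [RHS](reindex_inj (can_inj (port_moveK i8))). Qed.

Lemma port_variation (f : vertex -> R) i : (i < 8)%N ->
  \sum_x (f (vtx x 0) - f (vtx (port_move i x) 0)) ^+ 2
  <= (6 * 4 ^+ 15 + 3) * energy (diff_form f).
Proof.
move=> i8; pose D : R := 4 ^+ 15.
have sq v w : 0 <= diff_form f v w by exact: sqr_ge0.
have H1 := cells_le_energy sq; have H2 := port_le_energy sq i8.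
have H3 := port_moved_cells (cell_energy (diff_form f)) i8.
have D0 : 0 <= D by rewrite exprn_ge0.
apply: (@le_trans _ _ (3 * (D * \sum_x cell_energy (diff_form f) x) +
  3 * (\sum_x diff_form f (vtx x i) (vtx (port_move i x) (opp_port i))) +
  3 * (D * \sum_x cell_energy (diff_form f) (port_move i x)))); last first.
  rewrite H3 -/D; nra.
rewrite !mulr_sumr -!big_split /=; apply: ler_sum => x _.
have h1 := cell_variation15 f (port_lt_csize B x i8).
have h2 := cell_variation15 f (port_lt_csize B (port_move i x) (opp_port_lt i)).
rewrite -/D in h1 h2; rewrite {2}/diff_form.
set a := f (vtx x i) - _ in h1; set b := f (vtx _ (opp_port i)) - _ in h2.
set c := _ - f (vtx _ (opp_port i)).
have -> : f (vtx x 0) - f (vtx (port_move i x) 0) = c - a + b by rewrite /a /b /c; ring.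
have := sqr_ge0 (c + a); have := sqr_ge0 (c - b); have := sqr_ge0 (a + b); nra.
Qed.

Hypothesis torus_poincare : forall f : torus -> R, \sum_z f z = 0 ->
  \sum_z f z ^+ 2 <= 12 * \sum_z ((f z - f (shear1 z)) ^+ 2 + (f z - f (shear2 z)) ^+ 2
     + (f z - f (shift1 z)) ^+ 2 + (f z - f (shift2 z)) ^+ 2).

(** The first term bounds the variation inside the cells, the second the variation between them: 15
    bounds the size of a cell, 12 is the constant of the base, 4 counts the generators, and the last
    factor is that of [port_variation]. *)
Definition gap_const : R := 2 * 15 * 4 ^+ 15 + 2 * 15 * 12 * 4 * (6 * 4 ^+ 15 + 3).

Lemma sum_sqr_centered_le (T : finType) (f : T -> R) (c : R) : \sum_v f v = 0 ->
  \sum_v f v ^+ 2 <= \sum_v (f v - c) ^+ 2.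
Proof.
move=> f0.
have -> : \sum_v (f v - c) ^+ 2 = \sum_v f v ^+ 2 - 2 * c * \sum_v f v + \sum_(v : T) c ^+ 2.
  by rewrite mulr_sumr -sumrB -big_split; apply: eq_bigr => v _ /=; ring.
by rewrite f0 mulr0 subr0 lerDl sumr_ge0 // => v _; exact: sqr_ge0.
Qed.

Lemma cell_sum_le (F : torus -> R) : (forall x, 0 <= F x) ->
  \sum_(v : vertex) F (tag v) <= 15 * \sum_x F x.
Proof.
move=> F0; rewrite sum_vertex mulr_sumr; apply: ler_sum => x _.
rewrite (eq_bigr (fun=> F x)) // sumr_const card_ord -[leLHS]mulr_natl.
by rewrite ler_wpM2r // ler_nat csize_le.
Qed.

(** Each value is compared with the value at vertex 0 of its cell, a function on the base. That
    function is centred at its own mean [c]; as [f] has sum 0, subtracting [c] from [f] can only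
    increase the sum of squares, so this costs nothing. *)
Theorem graph_poincare (f : vertex -> R) : \sum_v f v = 0 ->
  \sum_v f v ^+ 2 <= gap_const * energy (diff_form f).
Proof.
move=> f0; pose D : R := 4 ^+ 15; pose N : R := #|torus|%:R.
pose c := (\sum_x f (vtx x 0)) / N.
have N0 : N != 0 by rewrite pnatr_eq0 -lt0n; apply/card_gt0P; exists (0, 0).
have sq v w : 0 <= diff_form f v w by exact: sqr_ge0.
have H1 := cells_le_energy sq.
have g0 : \sum_x (f (vtx x 0) - c) = 0.
  by rewrite sumrB sumr_const -mulr_natl /c mulrCA divff // mulr1 subrr.
have := torus_poincare g0; rewrite !big_split /=.
have simp (m : torus -> torus) : \sum_x (f (vtx x 0) - c - (f (vtx (m x) 0) - c)) ^+ 2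
    = \sum_x (f (vtx x 0) - f (vtx (m x) 0)) ^+ 2.
  by apply: eq_bigr => x _; congr (_ ^+ 2); ring.
rewrite !simp => G.
have := @port_variation f 0 isT; have := @port_variation f 1 isT.
have := @port_variation f 2 isT; have := @port_variation f 3 isT.
rewrite /= -/D => p3 p2 p1 p0.
have {p0 p1 p2 p3}G : \sum_x (f (vtx x 0) - c) ^+ 2 <=
    12 * (4 * ((6 * D + 3) * energy (diff_form f))) by lra.
have V1 : \sum_v (f v - f (vtx (tag v) 0)) ^+ 2 <= 15 * (D * \sum_x cell_energy (diff_form f) x).
  apply: (@le_trans _ _ (\sum_(v : vertex) (D * cell_energy (diff_form f) (tag v)))).
    apply: ler_sum => v _; rewrite -{1}(vtxE v); apply: cell_variation15; exact: idx_lt.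
  rewrite mulr_sumr; apply: (cell_sum_le (F := fun x => D * cell_energy (diff_form f) x)) => x.
  by rewrite mulr_ge0 ?exprn_ge0 // cell_energy_ge0.
have V2 := cell_sum_le (F := fun x => (f (vtx x 0) - c) ^+ 2) (fun x => sqr_ge0 _).
apply: le_trans (sum_sqr_centered_le c f0) _.
apply: (@le_trans _ _ (2 * (\sum_v (f v - f (vtx (tag v) 0)) ^+ 2) +
   2 * \sum_(v : vertex) (f (vtx (tag v) 0) - c) ^+ 2)).
  rewrite !mulr_sumr -big_split; apply: ler_sum => v _ /=.
  have := sqr_ge0 (f v - f (vtx (tag v) 0) - (f (vtx (tag v) 0) - c)); nra.
have D0 : 0 <= D by rewrite exprn_ge0.
rewrite /gap_const -/D; nra.
Qed.

(** On a triangle with values [a], [b], [d], [2 a = (a + b) + (a + d) - (b + d)]. The constant 45 is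
    3 times the size of a cell. *)
Theorem graph_antipoincare (f : vertex -> R) :
  \sum_v f v ^+ 2 <= 45 * energy (sum_form f).
Proof.
have sq v w : 0 <= sum_form f v w by exact: sqr_ge0.
apply: (@le_trans _ _ (\sum_(v : vertex) 3 * cell_energy (sum_form f) (tag v))).
  apply: ler_sum => v _.
  have [j [l [jx lx h1 h2 h3]]] := gadj_triangle (idx_lt v).
  have := term_le_cell sq (idx_lt v) jx h1.
  have := term_le_cell sq (idx_lt v) lx h2.
  have := term_le_cell sq jx lx h3.
  rewrite vtxE /sum_form => t1 t2 t3.
  set a := f v in t2 t3 *; set b := f _ in t1 t3; set d := f _ in t1 t2.
  have := sqr_ge0 ((a + b) - (a + d)); have := sqr_ge0 ((a + b) + (b + d)).
  have := sqr_ge0 ((a + d) + (b + d)); nra.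
apply: le_trans (cell_sum_le (F := fun x => 3 * cell_energy (sum_form f) x) _) _.
  by move=> x; rewrite mulr_ge0 // cell_energy_ge0.
rewrite -mulr_sumr mulrA; have := cells_le_energy sq; lra.
Qed.
End Energy.

(** * Induced cycles *)

Lemma gpath_check (P : bool -> nat -> nat -> bool) :
  (forall b, all (fun v => all (P b v) (iota 0 5)) (iota 0 (gsize b))) ->
  forall b v s, (v < gsize b)%N -> (s < 5)%N -> P b v s.
Proof.
move=> H b v s vb s5; have := allP (H b) v (gsize_iota vb) => /allP; apply.
by rewrite mem_iota.
Qed.

Lemma gpath_lt b v s : (v < gsize b)%N -> (s < 5)%N -> (gpath b v s < gsize b)%N.
Proof. by apply: (@gpath_check (fun b v s => gpath b v s < gsize b)%N); case; vm_compute. Qed.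

Lemma gpath_first b v : (v < gsize b)%N -> gpath b v 0 = 6%N.
Proof.
by move=> vb; apply/eqP; apply: (@gadget_check (fun b v => gpath b v 0 == 6%N)) vb; case; vm_compute.
Qed.

Lemma gpath_last b v : (v < gsize b)%N -> gpath b v 4 = 2%N.
Proof.
by move=> vb; apply/eqP; apply: (@gadget_check (fun b v => gpath b v 4 == 2%N)) vb; case; vm_compute.
Qed.

Lemma gpath_through b v : (v < gsize b)%N -> exists2 s, (s < 5)%N & gpath b v s = v.
Proof.
move=> vb; suff /hasP[s s5 /eqP e] : has (fun s => gpath b v s == v) (iota 0 5).
  by exists s; rewrite // mem_iota in s5.
by apply: (@gadget_check (fun b v => has (fun s => gpath b v s == v) (iota 0 5))) vb; case; vm_compute.
Qed.

Lemma gpath_induced b v s s' : (v < gsize b)%N -> (s < 5)%N -> (s' < 5)%N ->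
  gadj b (gpath b v s) (gpath b v s') = (s' == s.+1) || (s == s'.+1).
Proof.
move=> vb s5 s5'; apply/eqP.
have := @gpath_check (fun b v s => all (fun s' => gadj b (gpath b v s) (gpath b v s') ==
  ((s' == s.+1) || (s == s'.+1))) (iota 0 5)) _ b v s vb s5 => /(_ _)/allP; apply.
  by case; vm_compute.
by rewrite mem_iota.
Qed.

Lemma gpath_inj b v s s' : (v < gsize b)%N -> (s < 5)%N -> (s' < 5)%N ->
  gpath b v s = gpath b v s' -> s = s'.
Proof.
move=> vb s5 s5' e; apply/eqP; move/eqP: e; apply/implyP.
have := @gpath_check (fun b v s => all (fun s' => (gpath b v s == gpath b v s') ==> (s == s'))
  (iota 0 5)) _ b v s vb s5 => /(_ _)/allP; apply.
  by case; vm_compute.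
by rewrite mem_iota.
Qed.

Lemma gpath_port b v s : (v < gsize b)%N -> (s < 5)%N -> (gpath b v s < 8)%N ->
  [|| s == 0, s == 4 | gpath b v s == v]%N.
Proof.
move=> vb s5; apply/implyP; move: b v s vb s5.
by apply: gpath_check; case; vm_compute.
Qed.

Section Cycle.
Variables (k : nat) (B : {set torus k}) (v : vertex B).
Local Notation p := k.+2.
Local Notation vtx := (vtx B).

Definition row_cell (q : nat) : torus k := ((tag v).1 + inZp q, (tag v).2).

Lemma row_cellE q q' : (row_cell q == row_cell q') = (q == q' %[mod p]).
Proof. by rewrite xpair_eqE eqxx andbT (inj_eq (addrI _)) -val_eqE. Qed.

Lemma row_cell_succ q : shift1 (row_cell q) = row_cell q.+1.
Proof.
rewrite /shift1 /row_cell /= -addrA; congr (_ + _, _); apply/val_inj => /=.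
by rewrite modnDml addn1.
Qed.

Lemma row_cell0 : row_cell 0 = tag v.
Proof.
rewrite /row_cell; case: (tag v) => a b /=; congr (_, _).
by rewrite -[RHS]addr0; congr (_ + _); apply/val_inj; rewrite /= mod0n.
Qed.

(* The path through vertex 2 contains no port besides its two ends. *)
Definition row_target (q : nat) : nat := if q == 0%N then idx v else 2%N.
Definition row_path (q s : nat) : nat := gpath (row_cell q \in B) (row_target q) s.
Definition cycle_vertex (t : nat) : vertex B := vtx (row_cell (t %/ 5)) (row_path (t %/ 5) (t %% 5)).

Lemma row_target_lt q : (row_target q < gsize (row_cell q \in B))%N.
Proof.
rewrite /row_target; case: eqP => [->|_]; last by rewrite /gsize; case: (_ \in B).
by rewrite row_cell0; exact: idx_lt.
Qed.

Lemma row_path_lt q s : (s < 5)%N -> (row_path q s < csize B (row_cell q))%N.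
Proof. by move=> s5; apply: gpath_lt => //; exact: row_target_lt. Qed.

Lemma mod5_lt t : (t %% 5 < 5)%N. Proof. exact: ltn_mod. Qed.

Lemma div5_lt t : (t < 5 * p)%N -> (t %/ 5 < p)%N.
Proof. by move=> h; rewrite ltn_divLR // mulnC. Qed.

Lemma cycle_vertex_inj t t' : (t < 5 * p)%N -> (t' < 5 * p)%N ->
  cycle_vertex t = cycle_vertex t' -> t = t'.
Proof.
move=> /div5_lt h /div5_lt h' e.
have /eqP := congr1 tag e; rewrite !tag_vtx row_cellE !modn_small // => /eqP q.
have := congr1 (@idx _ B) e; rewrite !idx_vtx ?row_path_lt ?mod5_lt // -q.
move=> /(gpath_inj (row_target_lt _) (mod5_lt _) (mod5_lt _)) s.
by rewrite (divn_eq t 5) (divn_eq t' 5) q s.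
Qed.

Lemma cycle_vertex_mem : exists2 t, (t < 5 * p)%N & cycle_vertex t = v.
Proof.
have [s s5 e] := gpath_through (row_target_lt 0).
exists s; first by rewrite (leq_trans s5) // leq_pmulr.
rewrite /cycle_vertex divn_small // modn_small // row_cell0 /row_path e /row_target.
by rewrite vtxE.
Qed.

(* The only ports met by the chosen path of a cell are those of the first
   translation and, in the first cell, the target itself: an edge of another
   port would need the opposite port on the cycle. *)
Lemma cycle_port q s q' s' : (s < 5)%N -> (s' < 5)%N -> (row_path q s < 8)%N ->
  row_path q' s' = opp_port (row_path q s) -> (s = 0 /\ s' = 4 \/ s = 4 /\ s' = 0)%N.
Proof.
move=> s5 s5' i8 e.
have i8' : (row_path q' s' < 8)%N by rewrite e opp_port_lt.
have f u : row_path u 0 = 6%N by apply: gpath_first; exact: row_target_lt.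
have l u : row_path u 4 = 2%N by apply: gpath_last; exact: row_target_lt.
have uniq u r r' := @gpath_inj _ _ r r' (row_target_lt u).
have := gpath_port (row_target_lt q) s5 i8.
have := gpath_port (row_target_lt q') s5' i8'.
rewrite -!/(row_path _ _) => /or3P[]/eqP h' /or3P[]/eqP h.
- by move: e; rewrite h h' !f.
- by right.
- move: e; rewrite h' f => e; right; split => //; apply: (uniq q) => //.
  rewrite -/(row_path q s) -/(row_path q 4) l.
  by rewrite -(opp_portK i8) -e.
- by left.
- by move: e; rewrite h h' !l.
- move: e; rewrite h' l => e; left; split => //; apply: (uniq q) => //.
  rewrite -/(row_path q s) -/(row_path q 0) f.
  by rewrite -(opp_portK i8) -e.
- move: e; rewrite h f => e; left; split => //; apply: (uniq q') => //.
  by rewrite -/(row_path q' s') -/(row_path q' 4) l e.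
- move: e; rewrite h l => e; right; split => //; apply: (uniq q') => //.
  by rewrite -/(row_path q' s') -/(row_path q' 0) f e.
- case: (eqVneq q 0%N) => [q0|q0]; last first.
    have s4 : s = 4%N.
      by apply: (uniq q) => //; rewrite -/(row_path q s) -/(row_path q 4) l h /row_target (negbTE q0).
    right; split => //; apply: (uniq q') => //.
    by rewrite -/(row_path q' s') -/(row_path q' 0) f e s4 l.
  case: (eqVneq q' 0%N) => [q0'|q0']; last first.
    have s4 : s' = 4%N.
      by apply: (uniq q') => //; rewrite -/(row_path q' s') -/(row_path q' 4) l h' /row_target (negbTE q0').
    left; split => //; apply: (uniq q) => //.
    by rewrite -/(row_path q s) -/(row_path q 0) f -(opp_portK i8) -e s4 l.
  by have := opp_port_neq i8; rewrite -e h' h q0 q0' eqxx.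
Qed.

(** Position 4 in a cell is port 2, whose generator is the first translation, and position 0 of the
    next cell is the opposite port 6. The row closes up because this translation has order [p]. *)
Lemma cycle_succ_adj t : (t < 5 * p)%N ->
  adjv (cycle_vertex t) (cycle_vertex (t.+1 %% (5 * p))).
Proof.
move=> tL; have qp := div5_lt tL; have s5 := mod5_lt t; have te := divn_eq t 5.
have [s4|s4] := ltnP (t %% 5) 4.
  have e : (t.+1 %% (5 * p) = t %/ 5 * 5 + (t %% 5).+1)%N.
    by rewrite modn_small; lia.
  have eq : (t.+1 %% (5 * p) %/ 5 = t %/ 5)%N by rewrite e divnMDl // (@divn_small (t %% 5).+1) // addn0.
  have es : (t.+1 %% (5 * p) %% 5 = (t %% 5).+1)%N by rewrite e modnMDl (@modn_small (t %% 5).+1).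
  rewrite /cycle_vertex eq es /adjv !tag_vtx eqxx !idx_vtx ?row_path_lt //.
  by rewrite gpath_induced ?eqxx ?row_target_lt.
have s4e : (t %% 5 = 4)%N by lia.
have e : (t.+1 = (t %/ 5).+1 * 5)%N by lia.
have eL : (t.+1 %% (5 * p) = ((t %/ 5).+1 %% p) * 5)%N by rewrite e (mulnC 5) -muln_modl.
have eq : (t.+1 %% (5 * p) %/ 5 = (t %/ 5).+1 %% p)%N by rewrite eL mulnK.
have es : (t.+1 %% (5 * p) %% 5 = 0)%N by rewrite eL modnMl.
have f u : row_path u 0 = 6%N by apply: gpath_first; exact: row_target_lt.
have l u : row_path u 4 = 2%N by apply: gpath_last; exact: row_target_lt.
rewrite /cycle_vertex eq es s4e f l /adjv !idx_vtx ?port_lt_csize //.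
apply/orP; right; rewrite /= row_cell_succ row_cellE.
by rewrite modn_mod eqxx.
Qed.

Lemma cycle_adj t t' : (t < 5 * p)%N -> (t' < 5 * p)%N ->
  adjv (cycle_vertex t) (cycle_vertex t') <->
  (t' = t.+1 %% (5 * p) \/ t = t'.+1 %% (5 * p))%N.
Proof.
move=> tL tL'; split; last first.
  by case=> ->; [|rewrite adjv_sym]; exact: cycle_succ_adj.
have qp := div5_lt tL; have s5 := mod5_lt t; have te := divn_eq t 5.
have qp' := div5_lt tL'; have s5' := mod5_lt t'; have te' := divn_eq t' 5.
rewrite /adjv !tag_vtx !idx_vtx ?row_path_lt //.
have f u : row_path u 0 = 6%N by apply: gpath_first; exact: row_target_lt.
have l u : row_path u 4 = 2%N by apply: gpath_last; exact: row_target_lt.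
case/orP => [/andP[]|/and3P[i8]].
  rewrite row_cellE (modn_small qp) (modn_small qp') => /eqP q; rewrite -q gpath_induced ?row_target_lt //.
  by case/orP => /eqP h; [left | right]; rewrite modn_small; lia.
move=> hq /eqP hi; case: (cycle_port s5 s5' i8 hi) => -[h h'].
- right; move: hq; rewrite h f /= -(inj_eq (can_inj (@shift1K k))) shift1VK row_cell_succ.
  rewrite row_cellE [(t %/ 5 %% p)%N]modn_small // => /eqP e.
  have -> : (t'.+1 = (t' %/ 5).+1 * 5)%N by lia.
  by rewrite (mulnC 5) -muln_modl e; lia.
- left; move: hq; rewrite h l /= row_cell_succ row_cellE eq_sym.
  rewrite [(t' %/ 5 %% p)%N]modn_small // => /eqP e.
  have -> : (t.+1 = (t %/ 5).+1 * 5)%N by lia.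
  by rewrite (mulnC 5) -muln_modl e; lia.
Qed.
End Cycle.

(** * Random walk and Green function *)

(** Greedy choice: each chosen element discards itself and at most [d] others. *)
Lemma independent_set (T : finType) (bad : rel T) (d : nat) :
  symmetric bad -> (forall a, (#|[set b | bad a b]| <= d)%N) ->
  exists K : seq T, [/\ uniq K, (#|T| <= size K * d.+1)%N &
    {in K &, forall a b, a != b -> ~~ bad a b}].
Proof.
move=> bad_sym bad_le.
suff H m (A : {set T}) : (#|A| <= m)%N -> exists K : seq T,
    [/\ uniq K, {subset K <= A}, (#|A| <= size K * d.+1)%N &
    {in K &, forall a b, a != b -> ~~ bad a b}].
  have [K [u _ s i]] := H _ [set: T] (leqnn _).
  by exists K; split => //; rewrite -cardsT.
elim: m A => [A|m IH A Am].
  by rewrite leqn0 cards_eq0 => /eqP ->; exists [::]; split => //; rewrite cards0.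
have [->|[a aA]] := set_0Vmem A; first by exists [::]; split => //; rewrite cards0.
pose A' := (A :\ a) :\: [set b | bad a b].
have A'm : (#|A'| <= m)%N.
  by rewrite -ltnS (leq_trans _ Am) // (cardsD1 a A) aA add1n ltnS subset_leq_card // subsetDl.
have [K [u sK s i]] := IH A' A'm.
have aK b : b \in K -> (b != a) && ~~ bad a b.
  by move/sK; rewrite !inE => /andP[-> /andP[-> _]].
exists (a :: K); split => //=.
- by rewrite u andbT; apply/negP => /aK; rewrite eqxx.
- move=> b; rewrite inE => /orP[/eqP -> //|/sK].
  by rewrite !inE => /and3P[].
- rewrite (cardsD1 a A) aA mulSn addSn add1n ltnS.
  rewrite -(cardsID [set b | bad a b] (A :\ a)) leq_add //.
  by rewrite (leq_trans _ (bad_le a)) // subset_leq_card // subsetIr.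
- move=> b c; rewrite !inE => /orP[/eqP ->|bK] /orP[/eqP ->|cK]; rewrite ?eqxx //.
  + by case/andP: (aK c cK).
  + by rewrite bad_sym; case/andP: (aK b bK).
  + exact: i.
Qed.

(** * Contraction of the simple random walk *)

Section Walk.
Variables (R : realFieldType) (k : nat) (B : {set torus k}).
Local Notation torus := (torus k).
Local Notation vertex := (vertex B).
Hypothesis torus_poincare : forall f : torus -> R, \sum_z f z = 0 ->
  \sum_z f z ^+ 2 <= 12 * \sum_z ((f z - f (shear1 z)) ^+ 2 + (f z - f (shear2 z)) ^+ 2
     + (f z - f (shift1 z)) ^+ 2 + (f z - f (shift2 z)) ^+ 2).

Definition walk (f : vertex -> R) (v : vertex) : R := 6^-1 * \sum_(w | adjv v w) f w.
(** Edges being counted in both directions, the energies of differences and of sums are 12 times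
    [|f|^2 - <f, walk f>] and [|f|^2 + <f, walk f>]. The Poincaré inequality thus gives the upper
    bound [1 - 1 / (12 gap_const)] on the form of the walk; the constant 45 for sums gives the lower
    bound [-(1 - 1/540)], which [lambda] covers because [gap_const >= 45]. *)
Definition lambda : R := 1 - (12 * gap_const R)^-1.

Lemma gap_const_ge : 45 <= gap_const R.
Proof. rewrite /gap_const; have : 0 <= 4 ^+ 15 :> R by rewrite exprn_ge0. lra. Qed.

Lemma lambda_ge : 539 / 540 <= lambda.
Proof.
have := gap_const_ge; rewrite /lambda => h.
suff : (12 * gap_const R)^-1 <= 540^-1 by lra.
by rewrite lef_pV2 ?posrE //; lra.
Qed.

Lemma lambda_lt1 : lambda < 1.
Proof. by rewrite /lambda gtrBl invr_gt0; have := gap_const_ge; lra. Qed.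

Lemma sum_nbr_const (c : R) (v : vertex) : \sum_(w | adjv v w) c = 6 * c.
Proof. by rewrite sumr_const -sum1_card (adjv_degree v) mulr_natl. Qed.

Lemma sum_nbr_swap (F : vertex -> vertex -> R) :
  \sum_v \sum_(w | adjv v w) F v w = \sum_v \sum_(w | adjv v w) F w v.
Proof.
under eq_bigr do rewrite big_mkcond; rewrite exchange_big; apply: eq_bigr => v _ /=.
by rewrite -big_mkcond; apply: eq_bigl => w; rewrite adjv_sym.
Qed.

Lemma walk_sym (f g : vertex -> R) : \sum_v walk f v * g v = \sum_v f v * walk g v.
Proof.
transitivity (6^-1 * \sum_v \sum_(w | adjv v w) f w * g v).
  rewrite mulr_sumr; apply: eq_bigr => v _.
  by rewrite -mulrA mulr_suml.
rewrite sum_nbr_swap mulr_sumr; apply: eq_bigr => v _.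
by rewrite /walk [RHS]mulrCA -mulr_sumr.
Qed.

Lemma walk_const (c : R) v : walk (fun=> c) v = c.
Proof. by rewrite /walk sum_nbr_const mulKf // pnatr_eq0. Qed.

Lemma walk_sum (f : vertex -> R) : \sum_v walk f v = \sum_v f v.
Proof.
transitivity (\sum_v walk f v * 1); first by apply: eq_bigr => v _; rewrite mulr1.
by rewrite (walk_sym f (fun=> 1)); apply: eq_bigr => v _; rewrite walk_const mulr1.
Qed.

Lemma walk_lin (a b : R) (f g : vertex -> R) v :
  walk (fun w => a * f w + b * g w) v = a * walk f v + b * walk g v.
Proof. by rewrite /walk big_split /= -!mulr_sumr; ring. Qed.

Lemma eq_walk (f g : vertex -> R) : f =1 g -> walk f =1 walk g.
Proof. by move=> fg v; rewrite /walk; congr (_ * _); apply: eq_bigr. Qed.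

Lemma energy_expand (e : R) (f : vertex -> R) : e ^+ 2 = 1 ->
  \sum_v \sum_(w | adjv v w) (f v + e * f w) ^+ 2 =
  12 * \sum_v f v ^+ 2 + 12 * e * \sum_v f v * walk f v.
Proof.
move=> e1.
have S1 : \sum_v \sum_(w | adjv v w) f v ^+ 2 = 6 * \sum_v f v ^+ 2.
  by rewrite mulr_sumr; apply: eq_bigr => v _; rewrite sum_nbr_const.
have S2 : \sum_v \sum_(w | adjv v w) f w ^+ 2 = 6 * \sum_v f v ^+ 2.
  by rewrite sum_nbr_swap S1.
have S3 : \sum_v \sum_(w | adjv v w) f v * f w = 6 * \sum_v f v * walk f v.
  rewrite mulr_sumr; apply: eq_bigr => v _.
  by rewrite /walk mulrCA mulVKf ?pnatr_eq0 // mulr_sumr.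
have -> : 12 * \sum_v f v ^+ 2 + 12 * e * \sum_v f v * walk f v =
   6 * \sum_v f v ^+ 2 + 2 * e * (6 * \sum_v f v * walk f v) + 6 * \sum_v f v ^+ 2 by ring.
rewrite -{1}S1 -S2 -S3 mulr_sumr -!big_split /=; apply: eq_bigr => v _.
rewrite mulr_sumr -!big_split /=; apply: eq_bigr => w _.
by rewrite sqrrD exprMn e1; ring.
Qed.

Lemma walk_form_le (f : vertex -> R) : \sum_v f v = 0 ->
  \sum_v f v * walk f v <= lambda * \sum_v f v ^+ 2.
Proof.
move=> f0; have := graph_poincare torus_poincare f0.
have -> : energy (diff_form f) = 12 * \sum_v f v ^+ 2 + 12 * -1 * \sum_v f v * walk f v.
  rewrite -energy_expand ?sqrrN ?expr1n //; apply: eq_bigr => v _; apply: eq_bigr => w _.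
  by rewrite /diff_form mulN1r.
have g0 : 0 < gap_const R by have := gap_const_ge; lra.
rewrite -ler_pdivrMl // => h.
rewrite /lambda invfM mulrBl mul1r -mulrA.
set s := _^-1 * \sum_v _ in h *; lra.
Qed.

Lemma walk_form_ge (f : vertex -> R) :
  - (lambda * \sum_v f v ^+ 2) <= \sum_v f v * walk f v.
Proof.
have := graph_antipoincare f.
have -> : energy (sum_form f) = 12 * \sum_v f v ^+ 2 + 12 * 1 * \sum_v f v * walk f v.
  rewrite -energy_expand ?expr1n //; apply: eq_bigr => v _; apply: eq_bigr => w _.
  by rewrite /sum_form mul1r.
have := lambda_ge; have : 0 <= \sum_v f v ^+ 2 by apply: sumr_ge0 => v _; exact: sqr_ge0.
set s := \sum_v f v ^+ 2; set t := \sum_v _ * _; nra.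
Qed.

(* Polarization: testing the quadratic form on f + g and f - g with
   [g = walk f / lambda]. *)
Lemma walk_contraction (f : vertex -> R) : \sum_v f v = 0 ->
  \sum_v walk f v ^+ 2 <= lambda ^+ 2 * \sum_v f v ^+ 2.
Proof.
move=> f0; have l0 : 0 < lambda by have := lambda_ge; lra.
pose g v := lambda^-1 * walk f v.
have fg v : walk f v = lambda * g v by rewrite /g mulVKf // gt_eqF.
have H1 : \sum_v (f v + g v) = 0.
  by rewrite big_split /= /g -mulr_sumr walk_sum f0 mulr0 addr0.
have := walk_form_le H1; have := walk_form_ge (fun v => f v - g v).
have E e (e1 : e ^+ 2 = 1) : \sum_v (f v + e * g v) * walk (fun w => f w + e * g w) v =
    \sum_v f v * walk f v + \sum_v g v * walk g v + 2 * e * lambda * \sum_v g v ^+ 2.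
  have S : \sum_v f v * walk g v = lambda * \sum_v g v ^+ 2.
    by rewrite -walk_sym mulr_sumr; apply: eq_bigr => v _; rewrite fg -mulrA.
  have -> : 2 * e * lambda * \sum_v g v ^+ 2 =
     e * (\sum_v f v * walk g v) + e * lambda * \sum_v g v ^+ 2 by rewrite S; ring.
  rewrite !mulr_sumr -!big_split /=; apply: eq_bigr => v _.
  rewrite (eq_walk (g := fun w => 1 * f w + e * g w)); last by move=> w; rewrite mul1r.
  rewrite walk_lin !fg mul1r.
  have -> : (f v + e * g v) * (lambda * g v + e * walk g v) =
    f v * (lambda * g v) + e ^+ 2 * (g v * walk g v) + (e * (f v * walk g v) + e * lambda * g v ^+ 2) by ring.
  by rewrite e1 mul1r.
have E1 := E 1 (expr1n _ _); have E2 := E (-1) (etrans (sqrrN _) (expr1n _ _)).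
have -> : \sum_v (f v + g v) * walk (fun w => f w + g w) v =
   \sum_v f v * walk f v + \sum_v g v * walk g v + 2 * 1 * lambda * \sum_v g v ^+ 2.
  rewrite -E1; apply: eq_bigr => v _; rewrite mul1r; congr (_ * _).
  by apply: eq_walk => w; rewrite mul1r.
have -> : \sum_v (f v - g v) * walk (fun w => f w - g w) v =
   \sum_v f v * walk f v + \sum_v g v * walk g v + 2 * -1 * lambda * \sum_v g v ^+ 2.
  rewrite -E2; apply: eq_bigr => v _; rewrite mulN1r; congr (_ * _).
  by apply: eq_walk => w; rewrite mulN1r.
have P : \sum_v (f v + g v) ^+ 2 + \sum_v (f v - g v) ^+ 2 =
    2 * \sum_v f v ^+ 2 + 2 * \sum_v g v ^+ 2.
  by rewrite !mulr_sumr -!big_split /=; apply: eq_bigr => v _; ring.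
have -> : \sum_v walk f v ^+ 2 = lambda ^+ 2 * \sum_v g v ^+ 2.
  by rewrite mulr_sumr; apply: eq_bigr => v _; rewrite fg exprMn.
move=> h1 h2; rewrite ler_pM2l ?exprn_gt0 // -(ler_pM2l l0).
set u := lambda * _ in h1 h2; move: P h1 h2; rewrite /u.
set a := \sum_v f v ^+ 2; set b := \sum_v g v ^+ 2.
set c := \sum_v (f v + g v) ^+ 2; set d := \sum_v (f v - g v) ^+ 2 => P h1 h2.
have : lambda * c + lambda * d = lambda * (2 * a + 2 * b) by rewrite -P mulrDr.
lra.
Qed.

Definition walk_iter (t : nat) (f : vertex -> R) : vertex -> R := iter t walk f.

Lemma walk_iter_sum t f : \sum_v walk_iter t f v = \sum_v f v.
Proof. by elim: t => //= t IH; rewrite walk_sum. Qed.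

Lemma walk_iter_contraction t f : \sum_v f v = 0 ->
  \sum_v walk_iter t f v ^+ 2 <= (lambda ^+ t) ^+ 2 * \sum_v f v ^+ 2.
Proof.
move=> f0; elim: t => [|t IH]; first by rewrite expr1n mul1r.
have h : \sum_v walk_iter t f v = 0 by rewrite walk_iter_sum.
apply: le_trans (walk_contraction h) _.
by rewrite [lambda ^+ t.+1]exprS exprMn -[leRHS]mulrA ler_wpM2l ?sqr_ge0.
Qed.

Lemma walk_iter_sub t (f : vertex -> R) c v :
  walk_iter t (fun w => f w - c) v = walk_iter t f v - c.
Proof.
elim: t v => //= t IH v.
rewrite (eq_walk (g := fun w => 1 * walk_iter t f w + (-1) * c)); last first.
  by move=> w; rewrite IH; ring.
by rewrite (walk_lin 1 (-1) (walk_iter t f) (fun=> c)) walk_const; ring.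
Qed.

Lemma walk_iter_ge0 t (f : vertex -> R) v : (forall w, 0 <= f w) -> 0 <= walk_iter t f v.
Proof.
move=> f0; elim: t v => //= t IH v.
by rewrite mulr_ge0 ?invr_ge0 // sumr_ge0.
Qed.

Lemma walk_iter_sym t (f g : vertex -> R) :
  \sum_v walk_iter t f v * g v = \sum_v f v * walk_iter t g v.
Proof.
elim: t f g => //= t IH f g; rewrite walk_sym IH.
by apply: eq_bigr => v _; congr (_ * _); rewrite /walk_iter -iterSr.
Qed.

Definition in_cell (a : torus) (v : vertex) : R := (tag v == a)%:R.
Definition mass : R := #|vertex|%:R.

Lemma in_cell_ge0 a v : 0 <= in_cell a v. Proof. exact: ler0n. Qed.

Lemma sum_in_cell a : \sum_v in_cell a v = (csize B a)%:R.
Proof.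
rewrite sum_vertex (bigD1 a) //= [X in _ + X]big1 => [|x /negbTE xa]; last first.
  by rewrite big1 // => i _; rewrite /in_cell tag_vtx xa.
rewrite addr0 (eq_bigr (fun=> 1)); first by rewrite sumr_const card_ord.
by move=> i _; rewrite /in_cell tag_vtx eqxx.
Qed.

Lemma mass_gt0 : 0 < mass.
Proof. by rewrite ltr0n; apply/card_gt0P; exists (vtx B (0, 0) 0). Qed.

Lemma csize15 a : (csize B a)%:R <= 15 :> R.
Proof. by rewrite (ler_nat R _ 15) csize_le. Qed.

(** The indicator of a cell minus its mean has squared norm at most 15, hence norm at most 4, which
    contracts by [lambda] at each step; and a single value is at most the norm. *)
Lemma heat_le t a v : walk_iter t (in_cell a) v <= 15 / mass + 4 * lambda ^+ t.
Proof.
pose c := (csize B a)%:R / mass; pose f w := in_cell a w - c.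
have m0 := mass_gt0; have c15 := csize15 a.
have f0 : \sum_v f v = 0.
  by rewrite sumrB sum_in_cell sumr_const -[c *+ _]mulr_natl -/mass /c mulrCA divff ?mulr1 ?subrr // gt_eqF.
have l0 : 0 <= lambda ^+ t by rewrite exprn_ge0 //; have := lambda_ge; lra.
have f2 : \sum_v f v ^+ 2 <= 15.
  have -> : \sum_v f v ^+ 2 = \sum_v in_cell a v - 2 * c * \sum_v in_cell a v + mass * c ^+ 2.
    rewrite [mass * _]mulr_natl -sumr_const mulr_sumr -sumrB -big_split; apply: eq_bigr => u _ /=.
    by rewrite /f /in_cell; case: (tag u == a); rewrite ?mulr1n ?mulr0n; ring.
  rewrite sum_in_cell; have -> : mass * c ^+ 2 = c * (csize B a)%:R.
    by rewrite /c; field; rewrite gt_eqF.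
  suff : 0 <= c * (csize B a)%:R by lra.
  by rewrite !mulr_ge0 ?invr_ge0 ?ler0n // ltW.
have h := walk_iter_contraction t f0.
have hv : walk_iter t f v ^+ 2 <= (4 * lambda ^+ t) ^+ 2.
  apply: (@le_trans _ _ (\sum_v walk_iter t f v ^+ 2)).
    by rewrite (bigD1 v) //= lerDl sumr_ge0 // => u _; exact: sqr_ge0.
  apply: le_trans h _; rewrite exprMn mulrC ler_wpM2r ?sqr_ge0 //.
  by apply: le_trans f2 _; lra.
have : walk_iter t f v <= 4 * lambda ^+ t.
  rewrite (le_trans (ler_norm _)) // -(ler_pXn2r (n := 2)) ?nnegrE ?mulr_ge0 //.
  by rewrite -normrX ger0_norm ?sqr_ge0.
rewrite walk_iter_sub => h1.
suff : c <= 15 / mass by lra.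
by rewrite ler_wpM2r // invr_ge0 ltW.
Qed.

(** * Truncated Green functions of cells *)

Section Green.
Variable S : nat.
Hypothesis S_gt0 : (0 < S)%N.

Definition green (a : torus) (v : vertex) : R := \sum_(t < S) walk_iter t (in_cell a) v.

Lemma green_ge0 a v : 0 <= green a v.
Proof. by apply: sumr_ge0 => t _; apply: walk_iter_ge0 => w; exact: in_cell_ge0. Qed.

Lemma green_in v : 1 <= green (tag v) v.
Proof.
rewrite /green (bigD1 (Ordinal S_gt0)) //= {1}/in_cell eqxx lerDl.
by apply: sumr_ge0 => t _; apply: walk_iter_ge0 => w; exact: in_cell_ge0.
Qed.

(** The walk shifts time by one: the sum loses its first term, the indicator of the cell, which is 0
    at [v], and gains the term at time [S], bounded by [heat_le]. *)
Lemma green_step a v : tag v != a ->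
  walk (green a) v <= green a v + (15 / mass + 4 * lambda ^+ S).
Proof.
move=> va; have -> : walk (green a) v = \sum_(t < S) walk_iter t.+1 (in_cell a) v.
  rewrite /walk exchange_big mulr_sumr; apply: eq_bigr => t _ /=.
  by rewrite /walk.
have -> : \sum_(t < S) walk_iter t.+1 (in_cell a) v =
    green a v + walk_iter S (in_cell a) v.
  have h : \sum_(t < S.+1) walk_iter t (in_cell a) v = green a v + walk_iter S (in_cell a) v.
    by rewrite big_ord_recr.
  have e0 : in_cell a v = 0 by rewrite /in_cell (negbTE va).
  by rewrite -h big_ord_recl /= e0 add0r.
by rewrite lerD2l heat_le.
Qed.

(** Summing over the starting cell makes the Green function symmetric in the two cells, because the
    walk is self-adjoint; symmetry is what [independent_set] requires, and the sum dominates each of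
    its terms. *)
Definition cell_green (a b : torus) : R := \sum_v in_cell a v * green b v.

Lemma cell_green_sym a b : cell_green a b = cell_green b a.
Proof.
rewrite /cell_green /green; under eq_bigr do rewrite mulr_sumr.
under [RHS]eq_bigr do rewrite mulr_sumr.
rewrite exchange_big [RHS]exchange_big; apply: eq_bigr => t _ /=.
by rewrite -walk_iter_sym; apply: eq_bigr => v _; rewrite mulrC.
Qed.

Lemma green_le_cell v b : green b v <= cell_green (tag v) b.
Proof.
rewrite /cell_green (bigD1 v) //= {1}/in_cell eqxx mul1r lerDl.
by apply: sumr_ge0 => w _; rewrite mulr_ge0 ?in_cell_ge0 ?green_ge0.
Qed.

Lemma walk_iter_sum_fun (I : finType) (F : I -> vertex -> R) t v :
  walk_iter t (fun w => \sum_i F i w) v = \sum_i walk_iter t (F i) v.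
Proof.
elim: t v => //= t IH v; rewrite (eq_walk IH) /walk exchange_big mulr_sumr.
by apply: eq_bigr.
Qed.

Lemma cell_green_total a : \sum_b cell_green a b <= 15 * S%:R.
Proof.
have G v : \sum_b green b v = S%:R.
  rewrite /green exchange_big /= (eq_bigr (fun=> 1)); first by rewrite sumr_const card_ord.
  move=> t _; rewrite -walk_iter_sum_fun.
  elim: (t : nat) v => [|m IH] v /=.
    rewrite (bigD1 (tag v)) //= big1 => [|b /negbTE bv]; first by rewrite /in_cell eqxx addr0.
    by rewrite /in_cell eq_sym bv.
  by rewrite (eq_walk IH) walk_const.
rewrite exchange_big /=; under eq_bigr do rewrite -mulr_sumr G.
by rewrite -mulr_suml sum_in_cell ler_wpM2r ?ler0n ?csize15.
Qed.

(** Markov's inequality: the Green functions seen from one cell sum to at most [15 * S], so at most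
    [30 * S] of them exceed 1/2. *)
Lemma separated_cells : exists K : seq torus,
  [/\ uniq K, (#|torus| <= size K * (30 * S).+1)%N &
   forall b v, b \in K -> tag v \in K -> tag v != b -> green b v <= 1 / 2].
Proof.
pose bad (a b : torus) := 1 / 2 < cell_green a b.
have [|a|K [u s i]] := @independent_set _ bad (30 * S).
- by move=> a b; rewrite /bad cell_green_sym.
- have h : #|[set b | bad a b]|%:R <= (30 * S)%:R :> R.
    rewrite -sumr_const; have := cell_green_total a.
    have : \sum_(b in [set b | bad a b]) (1 / 2) <= \sum_b cell_green a b.
      rewrite big_mkcond; apply: ler_sum => b _; rewrite inE /bad; case: ifP => [/ltW //|_].
      by apply: sumr_ge0 => v _; rewrite mulr_ge0 ?in_cell_ge0 ?green_ge0.
    rewrite -mulr_suml natrM !sumr_const; lra.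
  by rewrite ler_nat in h.
exists K; split => // b v bK vK vb.
apply: le_trans (green_le_cell v b) _.
by rewrite leNgt; exact: (i (tag v) b vK bK vb).
Qed.
End Green.
End Walk.

(** * Spectral theorem *)

Section Spectral.
Variable R : rcfType.
Local Notation C := (complex.complex R).
Local Notation Re := (@complex.Re R).
Local Notation Im := (@complex.Im R).
Local Notation toC := (fun x : R => complex.real_complex R x : C).

Definition dotv n (u v : 'rV[R]_n) : R := \sum_i u 0 i * v 0 i.

Lemma dotvC n (u v : 'rV[R]_n) : dotv u v = dotv v u.
Proof. by apply: eq_bigr => i _; rewrite mulrC. Qed.
Lemma dotvZl n a (u v : 'rV[R]_n) : dotv (a *: u) v = a * dotv u v.
Proof. by rewrite mulr_sumr; apply: eq_bigr => i _; rewrite mxE mulrA. Qed.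
Lemma dotvDl n (u u' v : 'rV[R]_n) : dotv (u + u') v = dotv u v + dotv u' v.
Proof. by rewrite -big_split; apply: eq_bigr => i _; rewrite mxE mulrDl. Qed.
Lemma dotvBl n (u u' v : 'rV[R]_n) : dotv (u - u') v = dotv u v - dotv u' v.
Proof. by rewrite -scaleN1r dotvDl dotvZl mulN1r. Qed.
Lemma dotvE n (u v : 'rV[R]_n) : (u *m v^T) 0 0 = dotv u v.
Proof. by rewrite mxE; apply: eq_bigr => i _; rewrite mxE. Qed.
Lemma dotv_ge0 n (u : 'rV[R]_n) : 0 <= dotv u u.
Proof. by apply: sumr_ge0 => i _; rewrite -expr2 sqr_ge0. Qed.
Lemma dotv_eq0 n (u : 'rV[R]_n) : (dotv u u == 0) = (u == 0).
Proof.
apply/idP/eqP => [|->]; last by rewrite /dotv big1 // => i _; rewrite mxE mul0r.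
rewrite psumr_eq0 => [/allP h|i _]; last by rewrite -expr2 sqr_ge0.
apply/rowP => i; rewrite mxE; apply/eqP.
by have := h i (mem_index_enum i); rewrite mulf_eq0 orbb.
Qed.
Lemma dotv_mul_sym n (A : 'M[R]_n) (u v : 'rV[R]_n) : A^T = A ->
  dotv (u *m A) v = dotv u (v *m A).
Proof. by move=> As; rewrite -!dotvE trmx_mul As mulmxA. Qed.

(** Real and imaginary parts of an eigenvector for an eigenvalue [a + i b], which exists because the
    complex numbers over a real closed field are algebraically closed. *)
Lemma complex_eigenvector r (B : 'M[R]_r) : (0 < r)%N ->
  exists (x y : 'rV[R]_r) (a b : R), [/\ (x != 0) || (y != 0),
    x *m B = a *: x - b *: y & y *m B = b *: x + a *: y].
Proof.
move=> r0; pose BC := map_mx toC B.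
have /closed_rootP[c] : size (char_poly BC) != 1%N by rewrite size_char_poly; case: r r0 {B BC}.
rewrite -eigenvalue_root_char => /eigenvalueP[z zB z0].
have ReD (s t : C) : Re (s + t) = Re s + Re t by case: s t => [? ?] [].
have ImD (s t : C) : Im (s + t) = Im s + Im t by case: s t => [? ?] [].
have ReM (s : C) (t : R) : Re (s * toC t) = Re s * t.
  by case: s => s s' /=; rewrite mulr0 subr0.
have ImM (s : C) (t : R) : Im (s * toC t) = Im s * t.
  by case: s => s s' /=; rewrite mulr0 add0r.
exists (map_mx Re z), (map_mx Im z), (Re c), (Im c); split.
- apply: contraR z0; rewrite negb_or !negbK => /andP[/eqP/rowP h1 /eqP/rowP h2].
  apply/eqP/rowP => i; move: (h1 i) (h2 i); rewrite !mxE.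
  by case: (z 0 i) => [s t] /= -> ->.
- apply/rowP => i; move/rowP/(_ i)/(congr1 Re): zB; rewrite !mxE.
  rewrite (big_morph Re ReD (erefl : Re 0 = 0)) => h.
  transitivity (Re (c * z 0 i)).
    by rewrite -h; apply: eq_bigr => j _; rewrite !mxE ReM.
  by case: c {h} => a b; case: (z 0 i).
- apply/rowP => i; move/rowP/(_ i)/(congr1 Im): zB; rewrite !mxE.
  rewrite (big_morph Im ImD (erefl : Im 0 = 0)) => h.
  transitivity (Im (c * z 0 i)).
    by rewrite -h; apply: eq_bigr => j _; rewrite !mxE ImM.
  by case: c {h} => a b; case: (z 0 i) => s t /=; rewrite addrC.
Qed.

(** The rows of [B] span an invariant subspace. If [X + i Y] is an eigenvector in it for [a + i b],
    symmetry applied to [X] and [Y] gives [b (|X|^2 + |Y|^2) = 0], so [b = 0]. *)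
Lemma symmetric_eigenvector n (A : 'M[R]_n) r (B : 'M[R]_(r, n)) :
  A^T = A -> (0 < r)%N -> row_free B -> (B *m A <= B)%MS ->
  exists (w : 'rV[R]_n) (a : R), [/\ (w <= B)%MS, w != 0 & w *m A = a *: w].
Proof.
move=> As r0 Bf /submxP[D BA].
have [x [y [a [b [nz xD yD]]]]] := complex_eigenvector D r0.
pose X := x *m B; pose Y := y *m B.
have XA : X *m A = a *: X - b *: Y.
  by rewrite -mulmxA BA mulmxA xD mulmxBl -!scalemxAl.
have YA : Y *m A = b *: X + a *: Y.
  by rewrite -mulmxA BA mulmxA yD mulmxDl -!scalemxAl.
have X0 : (X != 0) = (x != 0) by rewrite /X mulmx_free_eq0.
have Y0 : (Y != 0) = (y != 0) by rewrite /Y mulmx_free_eq0.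
have b0 : b = 0.
  have := dotv_mul_sym X Y As; rewrite XA YA dotvBl !dotvZl.
  rewrite [dotv X (_ + _)]dotvC dotvDl !dotvZl [dotv Y X]dotvC => h.
  have := dotv_ge0 X; have := dotv_ge0 Y => gY gX.
  have : 0 < dotv X X + dotv Y Y.
    rewrite lt0r addr_ge0 // andbT paddr_eq0 // !dotv_eq0 negb_and.
    by rewrite X0 Y0.
  have : b * (dotv X X + dotv Y Y) = 0 by lra.
  by move/eqP; rewrite mulf_eq0 => /orP[/eqP //|/eqP ->]; rewrite ltxx.
rewrite b0 !scale0r ?subr0 ?add0r in XA YA.
case/orP: nz => nz; [exists X, a | exists Y, a]; split => //.
- exact: submxMl.
- by rewrite X0.
- exact: submxMl.
- by rewrite Y0.
Qed.

(** The orthogonal complement of an invariant subspace of a symmetric matrix is invariant, and has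
    positive dimension here. *)
Lemma orthonormal_extend n (A : 'M[R]_n) k (V : 'M[R]_(k, n)) (D : 'M[R]_k) :
  A^T = A -> (k < n)%N -> V *m A = D *m V ->
  exists (w : 'rV[R]_n) (a : R), [/\ w *m V^T = 0, dotv w w = 1 & w *m A = a *: w].
Proof.
move=> As kn VA.
pose B := row_base (kermx V^T).
have r0 : (0 < \rank (kermx V^T))%N.
  by rewrite mxrank_ker subn_gt0 (leq_ltn_trans _ kn) // rank_leq_col.
have BV : B *m V^T = 0 by apply/sub_kermxP; rewrite eq_row_base.
have BA : (B *m A <= B)%MS.
  rewrite eq_row_base; apply/sub_kermxP.
  have -> : B *m A *m V^T = B *m (V *m A)^T by rewrite trmx_mul As mulmxA.
  by rewrite VA trmx_mul mulmxA BV mul0mx.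
have [w [a [/submxP[E wE] w0 wA]]] := symmetric_eigenvector As r0 (row_base_free _) BA.
have wp : 0 < dotv w w by rewrite lt0r dotv_ge0 dotv_eq0 w0.
pose c := (Num.sqrt (dotv w w))^-1.
exists (c *: w), a; split.
- by rewrite wE -scalemxAl -mulmxA BV mulmx0 scaler0.
- rewrite dotvZl dotvC dotvZl mulrA /c -invfM -expr2 sqr_sqrtr ?dotv_ge0 //.
  by rewrite mulVf // gt_eqF.
- by rewrite -scalemxAl wA !scalerA mulrC.
Qed.

(** The first vector is prescribed so that it can be the constant one: the others are then
    orthogonal to constants, where the bounds on the walk apply. *)
Theorem orthonormal_eigenbasis n (A : 'M[R]_n) (u : 'rV[R]_n) (a : R) :
  A^T = A -> dotv u u = 1 -> u *m A = a *: u ->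
  exists (v : nat -> 'rV[R]_n) (mu : nat -> R), [/\ v 0%N = u, mu 0%N = a,
    forall i j, (i < n)%N -> (j < n)%N -> dotv (v i) (v j) = (i == j)%:R &
    forall i, (i < n)%N -> v i *m A = mu i *: v i].
Proof.
move=> As u1 uA.
have n0 : (0 < n)%N.
  case: n A u As u1 uA => // A u _; rewrite /dotv big_ord0 => /esym/eqP.
  by rewrite oner_eq0.
suff H k : (0 < k <= n)%N -> exists (v : nat -> 'rV[R]_n) (mu : nat -> R),
    [/\ v 0%N = u, mu 0%N = a,
    forall i j, (i < k)%N -> (j < k)%N -> dotv (v i) (v j) = (i == j)%:R &
    forall i, (i < k)%N -> v i *m A = mu i *: v i].
  by apply: H; rewrite n0 leqnn.
elim: k => // -[_ _|k IH /andP[_ kn]].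
  exists (fun=> u), (fun=> a); split=> // i j.
  by rewrite !ltnS !leqn0 => /eqP -> /eqP ->; rewrite u1.
have [v [mu [v0 mu0 vv vA]]] := IH (ltnW kn).
pose V := \matrix_(i < k.+1) v i.
have [|w [b [wV ww wA]]] := @orthonormal_extend n A k.+1 V (diag_mx (\row_i mu i)) As kn.
  by apply/row_matrixP => i; rewrite row_mul rowK vA // mul_diag_mx; apply/rowP => j; rewrite !mxE.
have wv i : (i < k.+1)%N -> dotv w (v i) = 0.
  move=> ik; have /rowP/(_ (Ordinal ik)) := wV; rewrite !mxE => h.
  by rewrite -[RHS]h; apply: eq_bigr => j _; rewrite !mxE.
exists (fun i => if (i < k.+1)%N then v i else w), (fun i => if (i < k.+1)%N then mu i else b).
split=> //.
- move=> i j; case: (ltnP i k.+1) => hi; case: (ltnP j k.+1) => hj ik jk.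
  + exact: vv.
  + by rewrite dotvC wv // (ltn_eqF (leq_trans hi hj)).
  + by rewrite wv // (gtn_eqF (leq_trans hj hi)).
  + have -> : i = j by apply/eqP; rewrite eqn_leq (leq_trans _ hj) // (leq_trans _ hi).
    by rewrite ww eqxx.
- by move=> i ik; case: ltnP => // h; rewrite vA.
Qed.
End Spectral.

End Expander.

Module Transfer.
Import mathcomp.boot.all_boot mathcomp.order.all_order mathcomp.algebra.all_algebra.
Import Expander.
Import mathcomp.reals_stdlib.Rstruct mathcomp.zify.zify.
Set Implicit Arguments. Unset Strict Implicit. Unset Printing Implicit Defensive.
Import Order.TTheory GRing.Theory Num.Theory.
Local Open Scope ring_scope.

(** * Characters of the torus *)

Section Characters.
Variable k : nat.
Local Notation p := k.+2.
Local Open Scope R_scope.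
Definition angle (x : nat) : R := 2 * PI * (INR x / INR p).

Lemma INRp_gt0 : 0 < INR p.
Proof. by apply: lt_0_INR; apply/ssrnat.ltP. Qed.

Lemma angleD_mod (x y z : nat) : (x + y = z \/ x + y = z + p)%N ->
  cos (angle x + angle y) = cos (angle z) /\ sin (angle x + angle y) = sin (angle z).
Proof.
have p0 := INRp_gt0.
have -> : angle x + angle y = angle (x + y) by rewrite /angle plus_INR; field; lra.
case=> ->; first by [].
have -> : angle (z + p) = angle z + 2 * INR 1 * PI.
  by rewrite /angle plus_INR (_ : INR 1 = 1) //; field; lra.
by rewrite cos_period sin_period.
Qed.

Lemma addI_mod (x y : 'I_p) : (x + y = (x + y)%R :> nat \/ x + y = (x + y)%R + p)%N.
Proof.
rewrite !val_addI; case: ltnP => h; first by left.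
by right; rewrite subnK.
Qed.

Definition co (x : 'I_p) : R := cos (angle x).
Definition si (x : 'I_p) : R := sin (angle x).

Lemma co0 : co 0%R = 1.
Proof. by rewrite /co /angle /= /Rdiv Rmult_0_l Rmult_0_r cos_0. Qed.
Lemma si0 : si 0%R = 0.
Proof. by rewrite /si /angle /= /Rdiv Rmult_0_l Rmult_0_r sin_0. Qed.
Lemma coD (x y : 'I_p) : co (x + y)%R = co x * co y - si x * si y.
Proof. by rewrite /co /si; have [<- _] := angleD_mod (addI_mod x y); rewrite cos_plus. Qed.
Lemma siD (x y : 'I_p) : si (x + y)%R = si x * co y + co x * si y.
Proof. by rewrite /co /si; have [_ <-] := angleD_mod (addI_mod x y); rewrite sin_plus. Qed.
Lemma character_norm (x : 'I_p) : co x * co x + si x * si x = 1.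
Proof. by have := sin2_cos2 (angle x); rewrite /Rsqr /co /si; lra. Qed.
(** Here and in [siN], the addition formulas at [x + (- x) = 0] are solved for the values at [- x],
    without computing the residue that represents it. *)
Lemma coN (x : 'I_p) : co (- x)%R = co x.
Proof.
have := coD x (- x)%R; have := siD x (- x)%R; rewrite subrr co0 si0 => h1 h2.
have h3 := character_norm x.
have -> : co (- x)%R = co (- x)%R * (co x * co x + si x * si x) by rewrite h3; ring.
transitivity (co x * (co x * co (- x)%R - si x * si (- x)%R)
    + si x * (si x * co (- x)%R + co x * si (- x)%R)); first by ring.
by rewrite -h1 -h2; ring.
Qed.
Lemma siN (x : 'I_p) : si (- x)%R = - si x.
Proof.
have := coD x (- x)%R; have := siD x (- x)%R; rewrite subrr co0 si0 => h1 h2.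
have h3 := character_norm x.
have -> : si (- x)%R = si (- x)%R * (co x * co x + si x * si x) by rewrite h3; ring.
transitivity (co x * (si x * co (- x)%R + co x * si (- x)%R)
   - si x * (co x * co (- x)%R - si x * si (- x)%R)); first by ring.
by rewrite -h1 -h2; ring.
Qed.

Lemma angle_le (a b c d : nat) : (a * b <= c * d)%N -> INR a * INR b <= INR c * INR d.
Proof. by move=> /ssrnat.leP h; rewrite -!mult_INR; apply: le_INR. Qed.

Lemma co_far (x : 'I_p) : (p <= 4 * x)%N -> (4 * x <= 3 * p)%N -> co x <= 0.
Proof.
rewrite -{1}(mul1n p) => /angle_le h1 /angle_le h2.
have p0 := INRp_gt0; have pi0 := PI_RGT_0.
have e : INR x = INR x / INR p * INR p by field; lra.
rewrite !S_INR /= in h1 h2.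
have h3 : 1 / 4 <= INR x / INR p by apply: (Rmult_le_reg_r (INR p)) => //; rewrite -e !S_INR; lra.
have h4 : INR x / INR p <= 3 / 4 by apply: (Rmult_le_reg_r (INR p)) => //; rewrite -e !S_INR; lra.
by apply: cos_le_0; rewrite /angle; nra.
Qed.

Lemma co_neq1 (x : 'I_p) : x != 0%R -> co x <> 1.
Proof.
move=> x0; have p0 := INRp_gt0; have pi0 := PI_RGT_0.
have hx : 0 < INR x by apply: lt_0_INR; apply/ssrnat.ltP; rewrite lt0n; apply: contra x0 => /eqP h; apply/eqP/val_inj.
have hxp : INR x < INR p by apply: lt_INR; apply/ssrnat.ltP.
have e : INR x = INR x / INR p * INR p by field; lra.
set t := INR x / INR p in e.
have t0 : 0 < t by apply: (Rmult_lt_reg_r (INR p)) => //; rewrite -e; lra.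
have t1 : t < 1 by apply: (Rmult_lt_reg_r (INR p)) => //; rewrite -e; lra.
have s0 : 0 < sin (PI * t) by apply: sin_gt_0; nra.
have -> : co x = cos (2 * (PI * t)) by rewrite /co /angle -/t; congr cos; ring.
rewrite cos_2a_sin; nra.
Qed.
End Characters.

Theorem torus_poincare (k : nat) (f : torus k -> R) : \sum_z f z = 0 ->
  \sum_z f z ^+ 2 <= 12%:R * \sum_z ((f z - f (shear1 z)) ^+ 2 + (f z - f (shear2 z)) ^+ 2
     + (f z - f (shift1 z)) ^+ 2 + (f z - f (shift2 z)) ^+ 2).
Proof.
apply: (torus_poincare_char (co := @co k) (si := @si k)).
- exact: co0.
- exact: si0.
- exact: coD.
- exact: siD.
- exact: coN.
- exact: siN.
- by move=> x x0; apply/eqP; exact: co_neq1.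
- by move=> x h1 h2; apply/RleP; exact: co_far.
Qed.

(** * Transfer to vertices numbered from 0 to n - 1 *)

Lemma list_seqE a n : List.seq a n = iota a n.
Proof. by elim: n a => //= n IH a; rewrite IH. Qed.

Lemma sumRE (T : Type) (l : seq T) (F : T -> R) : sumR l F = \sum_(x <- l) F x.
Proof. by elim: l => [|x l IH]; rewrite ?big_nil ?big_cons //= IH. Qed.

Lemma length_filterE (T : Type) (P : T -> bool) (l : seq T) : length (List.filter P l) = count P l.
Proof. by elim: l => //= x l <-; case: (P x). Qed.

Lemma parityE n f : parity n f = odd (count f (iota 0 n)).
Proof.
rewrite /parity list_seqE; elim: (iota 0 n) => //= x l ->.
by rewrite oddD oddb; case: (f x); case: (odd _).
Qed.

Lemma InE (T : eqType) (x : T) (l : seq T) : In x l <-> x \in l.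
Proof.
elim: l => //= a l IH; rewrite inE; split=> [[->|/IH ->]|/orP[/eqP ->|/IH]]; rewrite ?eqxx ?orbT //.
  by left.
by right.
Qed.

Lemma uniq_NoDup (T : eqType) (l : seq T) : uniq l -> NoDup l.
Proof.
elim: l => [_|a l IH /= /andP[h /IH h']]; first exact: NoDup_nil.
by apply: NoDup_cons => // /InE; apply/negP.
Qed.

Section Transport.
Variables (k : nat) (B : {set torus k}).
Local Notation p := k.+2.
Local Notation V := (vertex B).
Local Notation base := (vtx B (0, 0) 0).
Local Notation n := (size (enum V)).

Definition rank (v : V) : nat := index v (enum V).
Definition vert (u : nat) : V := nth base (enum V) u.
Definition adjn (u w : nat) : bool := [&& (u < n)%N, (w < n)%N & adjv (vert u) (vert w)].
Definition trin (u w : nat) : bool := [&& (u < n)%N, (w < n)%N & triv (vert u) (vert w)].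
Definition celln (u : nat) : nat := index (tag (vert u)) (enum (torus k)).

Lemma rank_lt v : (rank v < n)%N. Proof. by rewrite index_mem mem_enum. Qed.
Lemma rankK v : vert (rank v) = v. Proof. by rewrite /vert nth_index ?mem_enum. Qed.
Lemma vertK u : (u < n)%N -> rank (vert u) = u.
Proof. by move=> un; rewrite /rank index_uniq ?enum_uniq. Qed.

Lemma iota_rank : iota 0 n = [seq rank v | v <- enum V].
Proof.
apply: (@eq_from_nth _ 0%N) => [|i]; first by rewrite size_iota [RHS]size_map.
rewrite size_iota => i_n.
by rewrite nth_iota // (nth_map base) // -/(vert i) vertK.
Qed.

Lemma sumR_vertex (F : nat -> R) : sumR (List.seq 0 n) F = \sum_v F (rank v).
Proof. by rewrite list_seqE sumRE iota_rank big_map big_enum. Qed.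

Lemma sum_ord_vertex (F : nat -> R) : \sum_(i < n) F i = \sum_v F (rank v).
Proof. by rewrite -sumR_vertex list_seqE sumRE -[n in iota 0 n]subn0 big_mkord. Qed.

Lemma count_vertex (P : pred nat) : count P (iota 0 n) = (\sum_(v | P (rank v)) 1)%N.
Proof. by rewrite iota_rank count_map -sum1_count big_enum_cond. Qed.

Lemma adjn_rank v w : adjn (rank v) (rank w) = adjv v w.
Proof. by rewrite /adjn !rank_lt !rankK. Qed.
Lemma trin_rank v w : trin (rank v) (rank w) = triv v w.
Proof. by rewrite /trin !rank_lt !rankK. Qed.
Lemma adjn_vert u v : (u < n)%N -> adjn u (rank v) = adjv (vert u) v.
Proof. by move=> un; rewrite /adjn un rank_lt rankK. Qed.
Lemma trin_vert u v : (u < n)%N -> trin u (rank v) = triv (vert u) v.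
Proof. by move=> un; rewrite /trin un rank_lt rankK. Qed.

Lemma simple_adjn : simple_graph n adjn.
Proof.
split; first by move=> u v /and3P[/ssrnat.ltP ? /ssrnat.ltP].
split=> [u v|u]; rewrite /adjn; first by rewrite adjv_sym andbCA.
by rewrite adjv_irrefl !andbF.
Qed.

Lemma regular_adjn : regular n adjn 6.
Proof.
move=> v /ssrnat.ltP vn; rewrite /deg /neighbors list_seqE length_filterE count_vertex.
by rewrite -[RHS](adjv_degree (vert v)); apply: eq_bigl => w; rewrite adjn_vert.
Qed.

Lemma trin_adjn u v : trin u v = true -> adjn u v = true.
Proof. by rewrite /trin /adjn => /and3P[-> -> /triv_adjv]. Qed.
Lemma trin_sym u v : trin u v = trin v u.
Proof. by rewrite /trin triv_sym andbCA. Qed.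
Lemma trin_cell u v : trin u v = true -> celln u = celln v.
Proof. by rewrite /celln => /and3P[_ _ /andP[/eqP ->]]. Qed.

Lemma trin_even v : (v < n)%coq_nat -> parity n (trin v) = false.
Proof.
move=> /ssrnat.ltP vn; rewrite parityE count_vertex -[RHS](triv_even (vert v)).
by congr odd; apply: eq_bigl => w; rewrite trin_vert.
Qed.

Lemma out_even v : (v < n)%coq_nat -> parity n (fun u => adjn v u && negb (trin v u)) = false.
Proof.
move=> /ssrnat.ltP vn; rewrite parityE count_vertex.
have : odd (\sum_(w | adjv (vert v) w) 1)%N = false by rewrite adjv_degree.
rewrite (bigID (triv (vert v))) /= oddD.
rewrite (eq_bigl (triv (vert v))) => [|w]; last by apply: andb_idl; exact: triv_adjv.
rewrite triv_even /= => <-; congr odd.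
by apply: eq_bigl => w; rewrite adjn_vert // trin_vert.
Qed.

Lemma inv_INR6 : Rinv (INR 6) = 6^-1 :> R.
Proof. by rewrite INRE RinvE. Qed.

Lemma srw_vertex (f : nat -> R) v :
  srw n 6 adjn f (rank v) = walk (fun w => f (rank w)) v.
Proof.
rewrite /srw sumR_vertex /walk mulr_sumr [RHS]big_mkcond; apply: eq_bigr => w _ /=.
by rewrite adjn_rank inv_INR6 RmultE; case: ifP => // _; rewrite mul0r.
Qed.

(** The Green functions are truncated at time [p], and [19 = 15 + 4]: the stationary mass of a cell
    is at most [15 / n], and the hypothesis bounds the distance to stationarity at time [p] by
    [4 / n]. *)
Theorem adjn_cover_time : (4 * @lambda R ^+ p <= 4 / n%:R) ->
  exists (v0 : nat) (m : nat), [/\ (v0 < n)%N, (p ^ 2 <= m * (30 * p).+1)%N &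
   expected_cover_time_ge n adjn (lazy_rule n adjn trin) v0
     (Rmult (Rinv (Rmult (IZR 2) (Rdiv (INR 19) (INR n)))) (Rminus (ln (INR m)) (IZR 1)))].
Proof.
move=> lam.
have massE : mass R B = n%:R by rewrite /mass cardE.
have n0 : (0 < n)%N by apply: leq_ltn_trans (rank_lt base).
have [K [Ku Ks Kg]] := @separated_cells R k B p.
rewrite card_prod !card_ord mulnn in Ks.
have K0 : K != [::] by case: K Ks {Ku Kg}.
have [a0 a0K] : exists a0, a0 \in K.
  by case: K K0 {Ku Ks Kg} => // a K _; exists a; rewrite mem_head.
pose T := enum (torus k); pose dec (a : nat) : torus k := nth (0, 0) T a.
pose enc (a : torus k) : nat := index a T.
have encK a : dec (enc a) = a by rewrite /dec nth_index ?mem_enum.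
have cell_rank v : celln (rank v) = enc (tag v) by rewrite /celln rankK.
pose Kn := [seq enc a | a <- K].
have enc_inj : injective enc by exact: can_inj encK.
have mem_Kn a : In (enc a) Kn -> a \in K by move/InE; rewrite mem_map.
have Kn_dec b : In b Kn -> exists2 a, a \in K & b = enc a by move/InE/mapP.
exists (rank (vtx B a0 0)), (size K); split => //; first exact: rank_lt.
have gmem v : In (celln (rank v)) Kn -> tag v \in K by rewrite cell_rank => /mem_Kn.
have -> : size K = length Kn by rewrite /Kn -[RHS]/(size _) size_map.
apply: (@cover_time_ge_coupon n 6 adjn trin celln simple_adjn regular_adjn _ Kn
  (fun a u => green R p (dec a) (vert u))).
- exact: PeanoNat.Nat.lt_0_succ.
- by apply: uniq_NoDup; rewrite map_inj_uniq.
- apply/RltP; rewrite RdivE !INRE divr_gt0 // ltr0n //.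
- move=> b /Kn_dec[a aK ->]; exists (rank (vtx B a 8)), (rank (vtx B a 9)).
  have s9 : (9 < csize B a)%N by rewrite /csize /gsize; case: (a \in B).
  by rewrite cell_rank trin_rank /triv !idx_vtx ?(ltnW s9) //= eqxx.
- by move=> a u; apply/RleP; exact: green_ge0.
- move=> w /ssrnat.ltP wn; apply/RleP; rewrite /celln -/(enc _) encK.
  exact: green_in.
- move=> b u /ssrnat.ltP un /Kn_dec[a aK ->]; rewrite encK -(vertK un) cell_rank => h.
  rewrite srw_vertex; apply/RleP; rewrite rankK RplusE.
  have va : tag (vert u) != a by apply/eqP => e; apply: h; rewrite e.
  rewrite (eq_walk (g := green R p a)) => [|w]; last by rewrite rankK.
  apply: le_trans (green_step (@torus_poincare k) _ va) _.
  rewrite lerD2l massE RdivE !INRE.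
  have -> : 19%:R / n%:R = 15 / n%:R + 4 / n%:R :> R by rewrite -mulrDl -natrD.
  by rewrite lerD2l.
- move=> b u /ssrnat.ltP un /Kn_dec[a aK ->]; rewrite -(vertK un) => /gmem uK h.
  apply/RleP; rewrite encK rankK RdivE.
  by apply: (Kg a (vert u) aK uK); apply/eqP => e; apply: h; rewrite cell_rank e.
- exact: trin_adjn.
- exact: trin_sym.
- exact: trin_cell.
- exact: trin_even.
- exact: out_even.
- exact/ssrnat.ltP/rank_lt.
- by rewrite cell_rank; apply/InE/map_f.
Qed.
End Transport.

(** * Spectrum and cycles of the numbered graph *)

Section Spectrum.
Variables (k : nat) (B : {set torus k}).
Local Notation p := k.+2.
Local Notation V := (vertex B).
Local Notation n := (size (enum V)).
Local Notation adjn := (adjn B).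
Local Notation rank := (@rank k B).
Local Notation vert := (@vert k B).

Definition walk_matrix : 'M[R]_n := \matrix_(i, j) nadj adjn 6 i j.

Lemma walk_matrix_sym : walk_matrix^T = walk_matrix.
Proof.
apply/matrixP => i j; rewrite !mxE /nadj.
by have [_ [-> _]] := simple_adjn B.
Qed.

Definition coords (x : 'rV[R]_n) (u : nat) : R := oapp (x 0) 0 (insub u : option 'I_n).

Lemma coords_ord x (i : 'I_n) : coords x i = x 0 i.
Proof. by rewrite /coords valK. Qed.

Lemma mul_walk_matrix (x : 'rV[R]_n) (i : 'I_n) :
  (x *m walk_matrix) 0 i = walk (fun w => coords x (rank w)) (vert i).
Proof.
rewrite mxE; transitivity (\sum_(j < n) coords x j * nadj adjn 6 j i).
  by apply: eq_bigr => j _; rewrite coords_ord mxE.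
rewrite (sum_ord_vertex B (fun j => coords x j * nadj adjn 6 j i)) /walk mulr_sumr.
rewrite [RHS]big_mkcond; apply: eq_bigr => w _ /=.
have -> : nadj adjn 6 (rank w) i = if adjv (vert i) w then 6^-1 else 0.
  by rewrite /nadj (proj1 (proj2 (simple_adjn B))) adjn_vert // inv_INR6.
by case: ifP => _; rewrite ?mulr0 // mulrC.
Qed.

Lemma dotv_vertex (x y : 'rV[R]_n) :
  dotv x y = \sum_v coords x (rank v) * coords y (rank v).
Proof.
rewrite -(sum_ord_vertex B (fun j => coords x j * coords y j)).
by apply: eq_bigr => j _; rewrite !coords_ord.
Qed.

Theorem adjn_spectral : spectral_gap_le n adjn 6 (@lambda R).
Proof.
have n0 : 0 < n%:R :> R.
  by rewrite ltr0n; apply: leq_ltn_trans (rank_lt (vtx B (0, 0) 0)).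
pose c : R := Num.sqrt n%:R^-1.
have c2 : c * c = n%:R^-1 by rewrite -expr2 sqr_sqrtr // invr_ge0 ltW.
have c0 : c != 0.
  by apply/eqP => e; move/eqP: c2; rewrite e mulr0 eq_sym invr_eq0 gt_eqF.
pose u : 'rV[R]_n := const_mx c.
have uc w : coords u (rank w) = c.
  have -> : rank w = Ordinal (rank_lt w) :> nat by [].
  by rewrite coords_ord mxE.
have uu : dotv u u = 1.
  rewrite /dotv (eq_bigr (fun=> c * c)); last by move=> i _; rewrite !mxE.
  by rewrite sumr_const card_ord -mulr_natl c2 divff // gt_eqF.
have uA : u *m walk_matrix = 1 *: u.
  apply/rowP => i; rewrite mul_walk_matrix (eq_walk (g := fun=> c)) //.
  by rewrite walk_const scale1r mxE.
have [v [mu [v0 mu0 vv vA]]] := orthonormal_eigenbasis walk_matrix_sym uu uA.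
exists (fun i => coords (v i)), mu; split; [|split; [|split]] => //.
- move=> i j /ssrnat.ltP i_n /ssrnat.ltP j_n; rewrite sumR_vertex.
  transitivity (dotv (v i) (v j)); first by rewrite dotv_vertex.
  rewrite vv //; case: eqVneq => [->|ij]; first by rewrite PeanoNat.Nat.eqb_refl.
  by rewrite (proj2 (PeanoNat.Nat.eqb_neq i j)) //; apply/eqP.
- move=> i w /ssrnat.ltP i_n /ssrnat.ltP w_n.
  have := congr1 (fun x : 'rV_n => x 0 (Ordinal w_n)) (vA i i_n).
  rewrite /= mul_walk_matrix mxE -(coords_ord _ (Ordinal w_n)) /= => e.
  rewrite RmultE -e sumR_vertex /walk mulr_sumr [RHS]big_mkcond; apply: eq_bigr => z _ /=.
  by rewrite /nadj adjn_vert // inv_INR6 RmultE; case: ifP => // _; rewrite mul0r.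
(* For [i >= 1] the eigenvector has norm 1 and is orthogonal to the constant vector of index 0, so
   [mu i] is the value of the quadratic form of the walk at a function of sum 0. *)
- move=> i [/ssrnat.leP i1 /ssrnat.ltP i_n].
  pose f w := coords (v i) (rank w).
  have f0 : \sum_w f w = 0.
    apply: (mulfI c0); rewrite mulr0 mulr_sumr.
    have := vv 0%N i (leq_ltn_trans (leq0n _) i_n) i_n.
    rewrite v0 dotv_vertex eq_sym (gtn_eqF i1) => h.
    by rewrite -[RHS]h; apply: eq_bigr => w _; rewrite uc.
  have f2 : \sum_w f w ^+ 2 = 1.
    have := vv i i i_n i_n; rewrite dotv_vertex eqxx => h.
    by rewrite -[RHS]h; apply: eq_bigr => w _; rewrite expr2.
  have fw : \sum_w f w * walk f w = mu i.
    rewrite -[RHS]mulr1 -f2 mulr_sumr; apply: eq_bigr => w _.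
    have := congr1 (fun x : 'rV_n => x 0 (Ordinal (rank_lt w))) (vA i i_n).
    rewrite /= mul_walk_matrix mxE -(coords_ord _ (Ordinal (rank_lt w))) /= rankK => e.
    by rewrite -/f in e; rewrite e mulrCA -expr2.
  have := walk_form_le (@torus_poincare k) f0; have := walk_form_ge f.
  rewrite fw f2 !mulr1 => h1 h2.
  by apply/RleP; rewrite RabsE ler_norml h1 h2.
Qed.

Theorem adjn_cycle (u : nat) : (u < n)%N ->
  exists c, [/\ induced_cycle n adjn c, In u c & length c = (5 * p)%N].
Proof.
move=> un; pose v := vert u; pose c := [seq rank (cycle_vertex v t) | t <- iota 0 (5 * p)].
have cs : length c = (5 * p)%N by rewrite -[LHS]/(size c) size_map size_iota.
have cn i : (i < 5 * p)%N -> List.nth i c 0%N = rank (cycle_vertex v i).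
  move=> ip; have -> : List.nth i c 0%N = nth 0%N c i by elim: (c) (i) => [|a l IH] [|j] //=.
  by rewrite (nth_map 0%N) ?size_iota // nth_iota.
exists c; split => //.
- split; [|split; [|split]].
  + by rewrite cs; apply/ssrnat.leP; rewrite mulnS.
  + apply: uniq_NoDup; rewrite map_inj_in_uniq ?iota_uniq // => i j.
    rewrite !mem_iota /= add0n => ip jp e.
    by apply: (cycle_vertex_inj ip jp); exact: (can_inj (@rankK k B)) e.
  + apply/Forall_forall => x /InE/mapP[i _ ->]; apply/ssrnat.ltP; exact: rank_lt.
  + rewrite cs => i j /ssrnat.ltP ip /ssrnat.ltP jp.
    rewrite !cn // adjn_rank.
    have M (a : nat) : PeanoNat.Nat.modulo (a + 1)%coq_nat (5 * p) = (a.+1 %% (5 * p))%N.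
      symmetry; apply: (PeanoNat.Nat.mod_unique _ _ (a.+1 %/ (5 * p))); first exact/ssrnat.ltP/ltn_mod.
      by rewrite multE plusE addn1 mulnC -divn_eq.
    by rewrite !M; exact: cycle_adj.
- have [t tp e] := cycle_vertex_mem v.
  apply/InE/mapP; exists t; first by rewrite mem_iota.
  by rewrite e /v vertK.
Qed.
End Spectrum.

(** * Choice of the parameters *)

Lemma card_vertex k (B : {set torus k}) : size (enum (vertex B)) = (14 * k.+2 ^ 2 + #|B|)%N.
Proof.
rewrite -cardE -sum1_card.
have -> : (\sum_(v : vertex B) 1 = \sum_(x : torus k) \sum_(i < csize B x) 1)%N.
  exact: (sum_vertex (fun _ : vertex B => 1%N)).
rewrite (eq_bigr (fun x => 14 + (x \in B))%N) => [|x _]; last by rewrite sum_nat_const card_ord muln1.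
rewrite big_split /= sum_nat_const -big_mkcond sum1_card card_prod !card_ord mulnn mulnC.
by congr (_ + _)%N; apply: eq_card => x; rewrite !inE.
Qed.

Lemma exists_card_set (T : finType) r : (r <= #|T|)%N -> exists B : {set T}, #|B| = r.
Proof.
move=> rT; exists [set x in take r (enum T)].
rewrite cardsE; have /card_uniqP -> : uniq (take r (enum T)) by rewrite take_uniq // enum_uniq.
by rewrite size_takel // -cardE.
Qed.

(** Take [p] maximal with [14 p^2 <= n]. The remainder, to be the number of cells with 15 vertices,
    is less than [28 p + 14], which is at most [p^2] from [p = 29] on. *)
Lemma cell_grid (N n : nat) : (29 <= N)%N -> (14 * N.+1 ^ 2 <= n)%N ->
  exists k r, [/\ (N <= k.+2)%N, (r <= k.+2 ^ 2)%N & n = (14 * k.+2 ^ 2 + r)%N].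
Proof.
move=> N29 nN.
have ex : exists p, (14 * p ^ 2 <= n)%N by exists 0%N.
have bd p : (14 * p ^ 2 <= n)%N -> (p <= n)%N by rewrite expnS expn1; nia.
case: (ex_maxnP ex bd) => p p1 p2.
have Np : (N.+1 <= p)%N by exact: p2.
have pS : (n < 14 * p.+1 ^ 2)%N by rewrite ltnNge; apply/negP => /p2; rewrite ltnn.
case: p p1 {p2} Np pS => [|[|k]] // p1 Np pS; first by lia.
exists k, (n - 14 * k.+2 ^ 2)%N; split; first by lia.
  by move: p1 pS; rewrite !expnS !expn0 !muln1; nia.
by rewrite subnKC.
Qed.

Theorem walk_family : exists (lam0 eps c : R) (n0 : nat),
  Rlt lam0 (IZR 1) /\ Rlt (IZR 0) eps /\ Rlt (IZR 0) c /\
  forall n : nat, (n0 <= n)%coq_nat ->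
    exists adj : nat -> nat -> bool,
      simple_graph n adj /\ regular n adj 6 /\ spectral_gap_le n adj 6 lam0 /\
      (forall v, (v < n)%coq_nat -> exists cyc, induced_cycle n adj cyc /\ In v cyc /\
         Rle (Rmult eps (ln (INR n))) (INR (length cyc))) /\
      exists (v0 : nat) (rule : list nat -> nat -> R),
        (v0 < n)%coq_nat /\ valid_rule n adj rule /\
        expected_cover_time_ge n adj rule v0 (Rmult (Rmult c (INR n)) (ln (INR n))).
Proof.
pose lam : R := @lambda R.
have lam1 : Rlt lam (IZR 1) by apply/RltP; exact: lambda_lt1.
have lam_gt0 : Rlt (IZR 0) lam.
  by apply/RltP; apply: lt_le_trans (lambda_ge R); rewrite divr_gt0 // ltr0n.
have [p0 Hp0] := geometric_beats_square _ (conj lam_gt0 lam1).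
pose C := Rplus (Rmult (IZR 2) (ln (IZR 14415))) (IZR 4).
have [N1 HN1] := INR_unbounded (exp C).
pose N := (p0 + 29)%N.
(* [N1] makes [ln n] at least [C], for [coupon_bound]. The square makes [cell_grid] return
   [p >= N >= p0], so that [lam ^ p] is at most [1 / n]; the 29 in [N] is the threshold of
   [cell_grid]. *)
exists lam, (IZR 1), (Rinv (IZR 152)), (N1 + 14 * N.+1 ^ 2)%N.
split=> //; split; first by lra.
split; first by lra.
move=> n /ssrnat.leP hn.
have N29 : (29 <= N)%N by rewrite /N leq_addl.
have [|k [r [Nk rk nE]]] := @cell_grid N n N29; first by apply: leq_trans hn; rewrite leq_addl.
have [B Br] : exists B : {set torus k}, #|B| = r.
  by apply: exists_card_set; rewrite card_prod !card_ord mulnn.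
have en : size (enum (vertex B)) = n by rewrite card_vertex Br.
have n_gt0 : (0 < n)%N by rewrite nE addn_gt0 muln_gt0 expn_gt0.
have n15 : (n <= 15 * k.+2 ^ 2)%N by rewrite nE (mulnDl 14 1) mul1n leq_add2l.
have n15' : (n <= 15 * PeanoNat.Nat.pow k.+2 2)%coq_nat.
  by apply/ssrnat.leP; move: n15; rewrite /= expnS expn1; lia.
exists (adjn B).
have S := simple_adjn B; have Rg := @regular_adjn k B; have Sp := @adjn_spectral k B.
rewrite en in S Rg Sp.
split=> //; split=> //; split=> //; split.
  move=> v /ssrnat.ltP vn; have := @adjn_cycle k B v; rewrite en => /(_ vn) [c [c1 c2 c3]].
  exists c; split=> //; split=> //.
  rewrite c3 Rmult_1_l; apply: ln_le_cycle => //; first exact/ssrnat.ltP.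
  by apply/ssrnat.leP; apply: leq_trans Nk; rewrite /N; lia.
have lam_small : 4 * lam ^+ k.+2 <= 4 / (size (enum (vertex B)))%:R.
  rewrite en ler_wpM2l // -[leRHS]mul1r ler_pdivlMr ?ltr0n //.
  have /RleP := Hp0 k.+2 (@ssrnat.leP _ _ (leq_trans (leq_addr _ _) Nk)).
  apply: le_trans; rewrite !RmultE RpowE ler_wpM2l //.
    by rewrite exprn_ge0 // ltW //; apply/RltP.
  have -> : IZR 15 = 15%:R by rewrite -INRE INR_IZR_INZ.
  by rewrite RpowE INRE -natrX -natrM ler_nat.
have [v0 [m [v0n pm cov]]] := adjn_cover_time lam_small.
exists v0, (lazy_rule n (adjn B) (trin B)); rewrite en in v0n cov; split; first exact/ssrnat.ltP.
split; first exact: (lazy_rule_valid _ _ _ S (@trin_adjn k B)).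
move=> y hy; apply: cov; apply: Rlt_le_trans hy _.
apply: (coupon_bound n k.+2 m) => //.
- exact/ssrnat.ltP.
- by apply/ssrnat.leP.
- by apply/ssrnat.leP; move: pm; rewrite /= expnS expn1; lia.
- rewrite -/C; apply: Rnot_lt_le => h.
  have := exp_increasing _ _ h; rewrite exp_ln; last by apply: lt_0_INR; apply/ssrnat.ltP.
  have : Rle (INR N1) (INR n).
    by apply: le_INR; apply/ssrnat.leP; apply: leq_trans hn; rewrite leq_addr.
  by move=> h1 h2; lra.
Qed.

End Transfer.

Theorem mainTheorem6 :
  exists (lam0 eps c : R) (n0 : nat),
    lam0 < 1 /\ 0 < eps /\ 0 < c /\
    forall n : nat, (n0 <= n)%nat -> Nat.modulo n 3 = 0%nat ->
      exists (adj : nat -> nat -> bool),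
        simple_graph n adj /\
        regular n adj 6 /\
        spectral_gap_le n adj 6 lam0 /\
        (forall v, (v < n)%nat ->
           exists cyc, induced_cycle n adj cyc /\ In v cyc /\
                       eps * ln (INR n) <= INR (length cyc)) /\
        exists (v0 : nat) (rule : list nat -> nat -> R),
          (v0 < n)%nat /\ valid_rule n adj rule /\
          expected_cover_time_ge n adj rule v0 (c * INR n * ln (INR n)).
Proof.
destruct Transfer.walk_family as (lam0 & eps & c & n0 & H1 & H2 & H3 & H).
exists lam0, eps, c, n0; repeat split; auto.
Qed.
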